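(* Let $n\ge1$ and $m\ge n+1$. Then there exists a proper holomorphic map from $\mathbb{B}^n$ to $D^{III}_m$ that does not extend $C^2$-smoothly to any open piece of $\partial\mathbb{B}^n$; in particular it is not a holomorphic isometry.
   Context: $\mathbb{B}^n=\{z\in\mathbb{C}^n:|z|^2<1\}$; $D^{III}_m=\{Z\in M(m,m;\mathbb{C}): Z=Z^t,\ I_m-Z\overline{Z}^t>0\}$, with Bergman kernel $c(\det(I_m-Z\overline{Z}^t))^{-(m+1)}$. Bergman metric $\omega_\Omega=\sqrt{-1}\partial\bar\partial\log K_\Omega$; a holomorphic $F:D\to\Omega$ is a holomorphic isometry if $F^*\omega_\Omega=\lambda\omega_D$ for a constant $\lambda>0$. Proper means preimages of compact sets are compact. *)

(* Defs.v *)
From HB Require Import structures.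
From mathcomp Require Import all_boot all_order all_algebra.
From mathcomp Require Import all_classical all_reals all_analysis.
From mathcomp Require Import complex.
Import Order.TTheory GRing.Theory Num.Theory.
Import numFieldTopology.Exports numFieldNormedType.Exports.

Set Implicit Arguments.
Unset Strict Implicit.
Unset Printing Implicit Defensive.

Local Open Scope ring_scope.
Local Open Scope classical_set_scope.
Local Open Scope complex_scope.

(* The library gives every numClosedFieldType a (pseudo)metric topology, but
   this generic instance is not found by inference on the concrete type
   [complex R]; we copy it explicitly (no new mathematics: it is the usual
   topology of C given by the modulus). With it, 'rV[R[i]]_n (= C^n) and
   'M[R[i]]_m are normed modules over C with the usual topology. *)
HB.instance Definition _ (R : rcfType) := PseudoPointedMetric.copy R[i] (R[i])^o.

Section Defs.
Variable R : realType.
Local Notation C := (R[i]).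

Definition unit_ball (n : nat) : set 'rV[C]_n :=
  [set z | \sum_(i < n) `|z 0 i| ^+ 2 < 1].
Definition unit_sphere (n : nat) : set 'rV[C]_n :=
  [set z | \sum_(i < n) `|z 0 i| ^+ 2 = 1].
Arguments unit_ball : clear implicits.
Arguments unit_sphere : clear implicits.

Definition adjmx (p q : nat) (A : 'M[C]_(p, q)) : 'M[C]_(q, p) :=
  (map_mx conjc A)^T.

Definition posdef (p : nat) (A : 'M[C]_p) : Prop :=
  forall v : 'cV[C]_p, v != 0 -> 0 < (adjmx v *m A *m v) 0 0.

Definition D_III (m : nat) : set 'M[C]_m :=
  [set Z | Z^T = Z /\ posdef (1%:M - Z *m adjmx Z)].
Arguments D_III : clear implicits.

(* Holomorphic on an (open) set: complex (C-linear) Frechet differentiability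
   at every point of the set. *)
Definition holomorphic_on (n p q : nat) (U : set 'rV[C]_n)
    (F : 'rV[C]_n -> 'M[C]_(p, q)) : Prop :=
  forall z, U z -> differentiable F z.

Definition proper_map (n p q : nat) (A : set 'rV[C]_n) (B : set 'M[C]_(p, q))
    (F : 'rV[C]_n -> 'M[C]_(p, q)) : Prop :=
  (forall z, A z -> B (F z)) /\
  (forall K : set 'M[C]_(p, q), compact K -> K `<=` B ->
     compact (A `&` F @^-1` K)).

Definition realify (n : nat) (v : 'rV[R]_(n + n)) : 'rV[C]_n :=
  \row_i ((lsubmx v) 0 i +i* (rsubmx v) 0 i).

Definition ebasis (N : nat) (i : 'I_N) : 'rV[R]_N := delta_mx 0 i.

Definition C2_on (N : nat) (W : set 'rV[R]_N) (g : 'rV[R]_N -> R) : Prop :=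
  forall x, W x ->
    {for x, continuous g} /\
    forall i j : 'I_N,
      [/\ derivable g x (ebasis i),
          {for x, continuous ('D_(ebasis i) g)},
          derivable ('D_(ebasis i) g) x (ebasis j) &
          {for x, continuous ('D_(ebasis j) ('D_(ebasis i) g))}].

Definition C2_on_mx (N p q : nat) (W : set 'rV[R]_N)
    (G : 'rV[R]_N -> 'M[C]_(p, q)) : Prop :=
  forall (j : 'I_p) (k : 'I_q),
    C2_on W (fun v => complex.Re (G v j k)) /\ C2_on W (fun v => complex.Im (G v j k)).

Definition C2_extends_to_boundary_piece (n p q : nat)
    (F : 'rV[C]_n -> 'M[C]_(p, q)) : Prop :=
  exists (W : set 'rV[R]_(n + n)) (G : 'rV[R]_(n + n) -> 'M[C]_(p, q)),
    [/\ open W,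
        (exists v, W v /\ unit_sphere n (realify v)),
        C2_on_mx W G &
        (forall v, W v -> unit_ball n (realify v) -> G v = F (realify v))].

Definition d2_at0 (g : R -> R) : R := derive1 (derive1 g) 0.

(* Levi form / complex Hessian of a real function phi at Z in direction V:
   (i d d-bar phi)(V, \bar V) = d^2/dt d\bar t phi(Z + t V) |_{t=0}
                              = (1/4) (d_a^2 + d_b^2) phi(Z + (a + i b) V). *)
Definition levi (T : lmodType C) (phi : T -> R) (Z V : T) : R :=
  (d2_at0 (fun a => phi (Z + (a%:C) *: V))
   + d2_at0 (fun b => phi (Z + (0 +i* b) *: V))) / 4%:R.

(* Bergman potentials (log of the Bergman kernel on the diagonal, up to an
   additive constant, which does not affect i d d-bar):
   B^n:      K(z,z)  = c_n (1 - |z|^2)^{-(n+1)}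
   D^III_m:  K(Z,Z)  = c (det(I - Z \bar Z^t))^{-(m+1)}. *)
Definition bergman_pot_ball (n : nat) (z : 'rV[C]_n) : R :=
  - (n.+1)%:R * ln (1 - complex.Re (\sum_(i < n) `|z 0 i| ^+ 2)).
Definition bergman_pot_III (m : nat) (Z : 'M[C]_m) : R :=
  - (m.+1)%:R * ln (complex.Re (\det (1%:M - Z *m adjmx Z))).

(* F : B^n -> D^III_m is a holomorphic isometry (up to normalizing constant):
   F^* omega_{D^III_m} = lambda omega_{B^n} for some constant lambda > 0, i.e.
   the Bergman metric of D^III_m evaluated on dF_z(v) equals lambda times the
   Bergman metric of B^n on v, for all z in B^n and all v in C^n. *)
Definition holomorphic_isometry (n m : nat) (F : 'rV[C]_n -> 'M[C]_m) : Prop :=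
  holomorphic_on (unit_ball n) F /\
  exists lambda : R, 0 < lambda /\
    forall z v, unit_ball n z ->
      levi (@bergman_pot_III m) (F z) ('D_v F z)
      = lambda * levi (@bergman_pot_ball n) z v.

End Defs.

Arguments unit_ball {R} n _.
Arguments unit_sphere {R} n _.
Arguments D_III {R} m _.

(* Main.v *)
Require Import Defs.
From HB Require Import structures.
From mathcomp Require Import all_boot all_order all_algebra.
From mathcomp Require Import all_classical all_reals all_analysis.
From mathcomp Require Import complex.
From mathcomp Require Import ring lra.
Import Order.TTheory GRing.Theory Num.Theory.
Import numFieldTopology.Exports numFieldNormedType.Exports.
Local Open Scope ring_scope.
Local Open Scope complex_scope.

(** A bounded holomorphic function f with |f| < 1 may be adjoined as an extra diagonal entry to a
    proper map of the ball into D^III_n without destroying properness; so it suffices to take the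
    rational embedding (w, z) |-> [[w, z^T / sqrt 2], [z / sqrt 2, - z z^T / (2 (1 - w))]] and an f
    that is wild at every boundary point.

    We use f = p^(-1/2), where p - 1 is a sum of positive multiples of 1 / (1 - <z, a_k>) over a dense
    sequence a_k of unit vectors, symmetrised under z |-> - z.  Each summand has positive real part, so
    Re p > 1; and at distance t from a_k, along a line transversal to the sphere, |p| is of exact order
    1 / t, so |f| is of order sqrt t and f has no one-sided derivative there.

    The axis spanned by the first basis vector e is mapped to diagonal matrices, on which the Bergman
    metric is a sum of Poincare metrics.  An isometry would therefore make |f'|^2 / (1 - |f|^2)^2 a
    constant multiple of 1 / (1 - |w|^2)^2 on that axis; but f is even, so f'(0) = 0, whereas f' does
    not vanish at e / 2. *)

Set Implicit Arguments.
Unset Strict Implicit.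
Unset Printing Implicit Defensive.

(** The exponent -1/2 creates the roughness: [1 / p] would vanish at a pole to first order in the
    distance t, which a differentiable function may do, while exact order sqrt t rules out a
    derivative. Both sides of this order survive the density of the poles. All real parts are
    positive, so nothing cancels and a single summand bounds [Re p] from below; the summable weights
    bound |p| from above by a multiple of 1 / (1 - |z|^2), which is of order 1 / t along a
    transversal line. Values of p in the right half plane also keep the principal root holomorphic.
    An extension is tied to the map only inside the ball, so its value at the boundary point is
    unknown and must first be shown to vanish in the wild entry. Properness is obtained
    quantitatively: the Hermitian form of I - Z Z^* is written as a sum of squares in which 1 -
    |z|^2 is one of the coefficients. The factor 1 / sqrt 2 is there because the off-diagonal vector
    enters that coefficient twice. *)

(** * Weighted means of bounded sequences *)

Section DyadicMean.
Local Open Scope classical_set_scope.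
Variable R : realType.
Local Notation C := (R[i]).
Local Notation normc := (@Normc.normc R).
Implicit Types (x y : nat -> R) (b c : nat -> C).

(** The weights have total mass 1, so a bound on the terms is a bound on the mean. [limn] assigns a
    value to every sequence; the laws below assume boundedness, which gives convergence. *)
Definition dyadic_mean x : R := limn (series (fun k => x k / (2 ^ (k + 1))%:R)).

Lemma dyadic_gt0 k : 0 < ((2 ^ (k + 1))%:R : R).
Proof. by rewrite ltr0n expn_gt0. Qed.

Lemma cvg_dyadic_cst (M : R) :
  series (fun k => M / (2 ^ (k + 1))%:R) @ \oo --> M.
Proof.
by have := cvg_geometric_series_half M 0; rewrite expr0 divr1.
Qed.

Lemma is_cvg_dyadic x M : (forall k, `|x k| <= M) ->
  cvgn (series (fun k => x k / (2 ^ (k + 1))%:R)).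
Proof.
move=> xM; apply: (@normed_cvg R R^o).
apply: (@series_le_cvg R _ (fun k => M / (2 ^ (k + 1))%:R)) => [k|k|k|].
- exact: normr_ge0.
- by rewrite divr_ge0// (le_trans _ (xM 0%N)).
- have h : `|x k / (2 ^ (k + 1))%:R| <= M / (2 ^ (k + 1))%:R :> R.
    by rewrite normrM normfV (ger0_norm (ltW (dyadic_gt0 k))) ler_pM2r ?invr_gt0 ?dyadic_gt0.
  exact: h.
- by apply: (cvgP M); exact: cvg_dyadic_cst.
Qed.

Lemma dyadic_meanD x y M : (forall k, `|x k| <= M) -> (forall k, `|y k| <= M) ->
  dyadic_mean (fun k => x k + y k) = dyadic_mean x + dyadic_mean y.
Proof.
move=> xM yM; rewrite /dyadic_mean -lim_seriesD; last 2 first.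
- exact: is_cvg_dyadic xM.
- exact: is_cvg_dyadic yM.
by congr (limn (series _)); apply/funext => k; rewrite /= mulrDl.
Qed.

Lemma dyadic_meanZ x a M : (forall k, `|x k| <= M) ->
  dyadic_mean (fun k => a * x k) = a * dyadic_mean x.
Proof.
move=> xM; rewrite /dyadic_mean -[RHS]lim_seriesZ; last exact: is_cvg_dyadic xM.
by congr (limn (series _)); apply/funext => k; rewrite /= -mulrA.
Qed.

Lemma ler_dyadic_mean x y M : (forall k, `|x k| <= M) -> (forall k, `|y k| <= M) ->
  (forall k, x k <= y k) -> dyadic_mean x <= dyadic_mean y.
Proof.
move=> xM yM xy; apply: lim_series_le; [exact: is_cvg_dyadic xM|exact: is_cvg_dyadic yM|].
by move=> k; rewrite ler_pM2r ?invr_gt0 ?dyadic_gt0.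
Qed.

Lemma dyadic_mean_cst (M : R) : dyadic_mean (fun=> M) = M.
Proof. by apply: cvg_lim => //; exact: cvg_dyadic_cst. Qed.

Lemma normr_dyadic_mean x M : (forall k, `|x k| <= M) -> `|dyadic_mean x| <= M.
Proof.
move=> xM; have M0 : 0 <= M by apply: le_trans (xM 0%N).
have cM (k : nat) : `|M| <= M by rewrite ger0_norm.
have cN (k : nat) : `|- M| <= M by rewrite normrN ger0_norm.
rewrite ler_norml; apply/andP; split.
  rewrite -[leLHS]dyadic_mean_cst; apply: (ler_dyadic_mean cN xM) => k.
  by have := xM k; rewrite ler_norml => /andP[].
rewrite -[leRHS]dyadic_mean_cst; apply: (ler_dyadic_mean xM cM) => k.
by have := xM k; rewrite ler_norml => /andP[].
Qed.

(** Nonnegative terms make the partial sums nondecreasing. This is how one pole controls the whole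
    sum. *)
Lemma dyadic_mean_ge_term x M j : (forall k, `|x k| <= M) -> (forall k, 0 <= x k) ->
  x j / (2 ^ (j + 1))%:R <= dyadic_mean x.
Proof.
move=> xM x0.
have t0 k : 0 <= x k / (2 ^ (k + 1))%:R by rewrite divr_ge0// ltW// dyadic_gt0.
apply: le_trans (_ : series (fun k => x k / (2 ^ (k + 1))%:R) j.+1 <= _).
  by rewrite /series/= big_nat_recr//= lerDr sumr_ge0.
apply: nondecreasing_cvgn_le; last exact: is_cvg_dyadic xM.
by apply/nondecreasing_seqP => k; rewrite /series/= big_nat_recr//= lerDl.
Qed.

Lemma normr_Re_le_normc (z : C) : `|complex.Re z| <= normc z.
Proof.
case: z => a b /=; rewrite -sqrtr_sqr ler_sqrt ?lerDl ?sqr_ge0//.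
by rewrite addr_ge0 ?sqr_ge0.
Qed.

Lemma normr_Im_le_normc (z : C) : `|complex.Im z| <= normc z.
Proof.
case: z => a b /=; rewrite -sqrtr_sqr ler_sqrt ?lerDr ?sqr_ge0//.
by rewrite addr_ge0 ?sqr_ge0.
Qed.

Lemma normc_le_Re_Im (z : C) : normc z <= `|complex.Re z| + `|complex.Im z|.
Proof.
case: z => a b /=; rewrite -(@ler_pXn2r _ 2) ?nnegrE ?addr_ge0 ?sqrtr_ge0//.
rewrite sqr_sqrtr ?addr_ge0 ?sqr_ge0// sqrrD !real_normK ?num_real//.
by rewrite lerD2r lerDl mulrn_wge0// mulr_ge0.
Qed.

Lemma normcE (z : C) : `|z| = (normc z)%:C.
Proof. by []. Qed.

Lemma normc_ge0 (z : C) : 0 <= normc z.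
Proof. by case: z => a b; exact: sqrtr_ge0. Qed.

Definition dyadic_meanC b : C :=
  dyadic_mean (fun k => complex.Re (b k)) +i* dyadic_mean (fun k => complex.Im (b k)).

Lemma dyadic_meanCD b c M : (forall k, normc (b k) <= M) -> (forall k, normc (c k) <= M) ->
  dyadic_meanC (fun k => b k + c k) = dyadic_meanC b + dyadic_meanC c.
Proof.
move=> bM cM.
have bR k := le_trans (normr_Re_le_normc _) (bM k).
have bI k := le_trans (normr_Im_le_normc _) (bM k).
have cR k := le_trans (normr_Re_le_normc _) (cM k).
have cI k := le_trans (normr_Im_le_normc _) (cM k).
transitivity (dyadic_mean (fun k => complex.Re (b k) + complex.Re (c k)) +i*
  dyadic_mean (fun k => complex.Im (b k) + complex.Im (c k))); last first.
  by rewrite (dyadic_meanD bR cR) (dyadic_meanD bI cI).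
by congr (dyadic_mean _ +i* dyadic_mean _); apply/funext => k; case: (b k); case: (c k).
Qed.

Lemma dyadic_meanCZ b (a : C) M : (forall k, normc (b k) <= M) ->
  dyadic_meanC (fun k => a * b k) = a * dyadic_meanC b.
Proof.
move=> bM; case: a => u v.
have bR k := le_trans (normr_Re_le_normc _) (bM k).
have bI k := le_trans (normr_Im_le_normc _) (bM k).
have M0 : 0 <= M by apply: le_trans (bR 0%N).
have bd (t : R) x : `|t| <= `|u| + `|v| -> (forall k, `|x k| <= M) ->
    forall k, `|t * x k| <= (`|u| + `|v|) * M.
  by move=> tb xM k; rewrite normrM ler_pM.
have ub : `|u| <= `|u| + `|v| by rewrite lerDl.
have vb : `|- v| <= `|u| + `|v| by rewrite normrN lerDr.
have vb' : `|v| <= `|u| + `|v| by rewrite lerDr.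
transitivity (dyadic_mean (fun k => u * complex.Re (b k) + (- v) * complex.Im (b k)) +i*
  dyadic_mean (fun k => u * complex.Im (b k) + v * complex.Re (b k))); last first.
  rewrite (dyadic_meanD (bd _ _ ub bR) (bd _ _ vb bI)).
  rewrite (dyadic_meanD (bd _ _ ub bI) (bd _ _ vb' bR)).
  by rewrite (dyadic_meanZ _ bR) (dyadic_meanZ _ bI) (dyadic_meanZ _ bI) (dyadic_meanZ _ bR) mulNr.
by congr (dyadic_mean _ +i* dyadic_mean _); apply/funext => k; case: (b k) => p q /=; rewrite ?mulNr.
Qed.

(** Real and imaginary parts are bounded separately, which costs a factor 2 that reappears in later
    constants. *)
Lemma normc_dyadic_meanC b M : (forall k, normc (b k) <= M) ->
  normc (dyadic_meanC b) <= M + M.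
Proof.
move=> bM; apply: le_trans (normc_le_Re_Im _) _.
by apply: lerD; apply: normr_dyadic_mean => k; apply: le_trans (bM k);
  rewrite ?normr_Re_le_normc ?normr_Im_le_normc.
Qed.

End DyadicMean.

(** * A differentiability criterion *)

Section QuadraticRemainder.
Local Open Scope classical_set_scope.
Variables (K : numFieldType) (V W : normedModType K).

(** An error of second order is little-o of [h], and the bound by [k] makes [df] continuous, as a
    differential must be. It serves both the infinite pole sum and the square root. *)
Lemma is_diff_quadratic_remainder (f df : V -> W) (z : V) (k c r : K) :
  linear df -> 0 <= k -> 0 <= c -> 0 < r ->
  (forall h, `|df h| <= k * `|h|) ->
  (forall h, `|h| < r -> `|f (h + z) - f z - df h| <= c * `|h| ^+ 2) ->
  is_diff z f df.
Proof.
move=> dfl k0 c0 r0 dfk fr.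
(* The bounds [k] and [c] may be 0, and the neighbourhoods below divide by them. *)
have k1 : 0 < k + 1 by rewrite ltr_wpDl.
have c1 : 0 < c + 1 by rewrite ltr_wpDl.
pose dM := GRing.isLinear.Build _ _ _ _ _ dfl.
pose dL : {linear V -> W} := HB.pack df dM.
have dc : continuous dL.
  move=> x; apply/cvgrPdist_le => e e0; near=> y.
  rewrite -linearB (le_trans (dfk _))//.
  rewrite (@le_trans _ _ ((k + 1) * `|x - y|))// ?ler_wpM2r// ?lerDl//.
  rewrite mulrC -ler_pdivlMr//.
  by near: y; apply: cvgr_dist_le => //; rewrite divr_gt0.
have ex : f \o shift z = cst (f z) + dL +o_ 0 id.
  apply/eqaddoP => _/posnumP[e]; near=> h.
  rewrite !fctE /= opprD addrA.
  apply: (le_trans (fr _ _)).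
    by near: h; apply: (@cvgr0_norm_lt _ _ _ (nbhs (0:V)) _ id); [exact: cvg_id|].
  rewrite expr2 mulrA ler_wpM2r//.
  rewrite (@le_trans _ _ ((c + 1) * `|h|))// ?ler_wpM2r// ?lerDl//.
  rewrite mulrC -ler_pdivlMr//.
  by near: h; apply: (@cvgr0_norm_le _ _ _ (nbhs (0:V)) _ id); [exact: cvg_id|exact: divr_gt0].
have dE := diff_unique dc ex.
by apply: DiffDef => //; apply/diff_locallyP; rewrite dE.
Unshelve. all: by end_near. Qed.

End QuadraticRemainder.

(** * Holomorphy of sums of poles *)

Section PoleSum.
Local Open Scope classical_set_scope.
Variable R : realType.
Local Notation C := (R[i]).
Local Notation normc := (@Normc.normc R).

Definition hdot N (z a : 'rV[C]_N) : C := \sum_i z 0 i * conjc (a 0 i).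
Definition sqnorm N (z : 'rV[C]_N) : R := \sum_i normc (z 0 i) ^+ 2.

Lemma sqnorm_ge0 N (z : 'rV[C]_N) : 0 <= sqnorm z.
Proof. by apply: sumr_ge0 => i _; rewrite exprn_ge0 ?normc_ge0. Qed.

Lemma sum_normr_sqnorm N (z : 'rV[C]_N) : \sum_i `|z 0 i| ^+ 2 = (sqnorm z)%:C.
Proof. by rewrite rmorph_sum; apply: eq_bigr => i _; rewrite rmorphXn. Qed.

Lemma unit_ballE N (z : 'rV[C]_N) : unit_ball N z <-> sqnorm z < 1.
Proof. by rewrite /unit_ball/= sum_normr_sqnorm ltcR. Qed.

Lemma unit_sphereE N (z : 'rV[C]_N) : unit_sphere N z <-> sqnorm z = 1.
Proof.
rewrite /unit_sphere/= sum_normr_sqnorm; split=> [|->//].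
by move=> h; apply: (@complexI R).
Qed.

Lemma normcN (z : C) : normc (- z) = normc z.
Proof. by apply: (@complexI R); rewrite -!normcE normrN. Qed.

Lemma normc_conjc (z : C) : normc (conjc z) = normc z.
Proof. by apply: (@complexI R); rewrite -!normcE normcJ. Qed.

Lemma normcX2 (z : C) : normc (z ^+ 2) = normc z ^+ 2.
Proof. by rewrite !expr2 Normc.normcM. Qed.

Lemma normc_sub_ge (x y : C) : normc x - normc y <= normc (x - y).
Proof. by rewrite lerBlDr -{1}(subrK y x) complex.le_normcD. Qed.

Lemma normc_sum (I : finType) (F : I -> C) : normc (\sum_i F i) <= \sum_i normc (F i).
Proof.
elim/big_ind2 : _ => [|x a y b xa yb|//]; first by rewrite Normc.normc0.
by apply: le_trans (complex.le_normcD _ _) _; exact: lerD.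
Qed.

Lemma normc_coord N (z : 'rV[C]_N) i : normc (z 0 i) ^+ 2 <= sqnorm z.
Proof.
by rewrite /sqnorm (bigD1 i)//= lerDl sumr_ge0// => j _; rewrite exprn_ge0 ?normc_ge0.
Qed.

Lemma normc_coord_le1 N (z : 'rV[C]_N) i : sqnorm z <= 1 -> normc (z 0 i) <= 1.
Proof.
move=> z1; rewrite -(@ler_pXn2r _ 2) ?nnegrE ?normc_ge0// expr1n.
exact: le_trans (normc_coord _ _) z1.
Qed.

(* AM-GM replaces Cauchy-Schwarz: this keeps [1 - <z, a>] away from 0 in the ball without square roots. *)
Lemma normc_hdot N (z a : 'rV[C]_N) : sqnorm a <= 1 -> normc (hdot z a) <= (sqnorm z + 1) / 2.
Proof.
move=> a1; apply: le_trans (normc_sum _) _.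
apply: (@le_trans _ _ ((sqnorm z + sqnorm a) / 2)); last by rewrite ler_pM2r// lerD2l.
rewrite /sqnorm -big_split/= mulr_suml ler_sum// => i _.
rewrite Normc.normcM normc_conjc.
move: (normc (z 0 i)) (normc (a 0 i)) => x y.
by have := sqr_ge0 (x - y); nra.
Qed.

(** The norm of a matrix is the largest modulus of its entries, but with values in [C]; this is the
    same number in [R]. It is not the Euclidean length behind [sqnorm], whence the factors [N]
    below. *)
Definition mxnormc p q (h : 'M[C]_(p, q)) : R := complex.Re `|h|.

Lemma mxnormcE p q (h : 'M[C]_(p, q)) : `|h| = (mxnormc h)%:C.
Proof. by rewrite RRe_real// normr_real. Qed.

Lemma mxnormc_ge0 p q (h : 'M[C]_(p, q)) : 0 <= mxnormc h.
Proof. rewrite -lecR -mxnormcE; exact: normr_ge0. Qed.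

Lemma normc_le_mxnormc p q (h : 'M[C]_(p, q)) i j : normc (h i j) <= mxnormc h.
Proof.
rewrite -lecR -mxnormcE -[X in X <= _]/(`|h i j|) [leRHS]/Num.Def.normr/= mx_normE.
rewrite -[leLHS]nngE num_le.
exact: (le_bigmax _ _ (i, j)).
Qed.

Lemma normc_hdot_mxnormc N (h a : 'rV[C]_N) : sqnorm a <= 1 ->
  normc (hdot h a) <= N%:R * mxnormc h.
Proof.
move=> a1; apply: le_trans (normc_sum _) _.
rewrite -[X in X%:R]card_ord -sum1_card natr_sum mulr_suml ler_sum// => i _.
rewrite mul1r Normc.normcM normc_conjc -[leRHS]mulr1.
by rewrite ler_pM ?normc_ge0 ?normc_coord_le1 ?normc_le_mxnormc.
Qed.

Lemma hdotDl N (x y a : 'rV[C]_N) : hdot (x + y) a = hdot x a + hdot y a.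
Proof. by rewrite /hdot -big_split; apply: eq_bigr => i _; rewrite mxE mulrDl. Qed.

Lemma hdotZl N t (x a : 'rV[C]_N) : hdot (t *: x) a = t * hdot x a.
Proof. by rewrite /hdot mulr_sumr; apply: eq_bigr => i _; rewrite mxE mulrA. Qed.

Definition pole_sum N (a : nat -> 'rV[C]_N) (z : 'rV[C]_N) : C :=
  dyadic_meanC (fun k => (1 - hdot z (a k))^-1).
Definition pole_sum_diff N (a : nat -> 'rV[C]_N) (z h : 'rV[C]_N) : C :=
  dyadic_meanC (fun k => hdot h (a k) / (1 - hdot z (a k)) ^+ 2).

Section Poles.
Variables (N : nat) (a : nat -> 'rV[C]_N).
Hypothesis a1 : forall k, sqnorm (a k) <= 1.

Let rho (z : 'rV[C]_N) : R := (1 - sqnorm z) / 2.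

Lemma normc_pole_ge z k : (1 - sqnorm z) / 2 <= normc (1 - hdot z (a k)).
Proof.
have := normc_sub_ge 1 (hdot z (a k)); rewrite Normc.normc1.
by have := normc_hdot z (a1 k); lra.
Qed.

Let rho_gt0 z : sqnorm z < 1 -> 0 < rho z.
Proof. by move=> z1; rewrite /rho; lra. Qed.

Lemma pole_neq0 z k : sqnorm z < 1 -> 1 - hdot z (a k) != 0.
Proof.
move=> z1; apply/eqP => h; have := normc_pole_ge z k; rewrite h Normc.normc0.
by have := rho_gt0 z1; rewrite /rho; lra.
Qed.

Lemma normc_pole_inv z k : sqnorm z < 1 ->
  normc (1 - hdot z (a k))^-1 <= ((1 - sqnorm z) / 2)^-1.
Proof.
move=> z1; have r0 := rho_gt0 z1.
by rewrite Normc.normcV lef_pV2 ?posrE// ?(lt_le_trans r0)// normc_pole_ge.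
Qed.

Let normc_dpole z h k : sqnorm z < 1 ->
  normc (hdot h (a k) / (1 - hdot z (a k)) ^+ 2) <= (N%:R * mxnormc h) * (rho z)^-1 ^+ 2.
Proof.
move=> z1; have hp := normc_hdot_mxnormc h (a1 k); have hi := normc_pole_inv k z1.
rewrite Normc.normcM -exprVn normcX2 ler_pM ?exprn_ge0 ?normc_ge0//.
by rewrite ler_pXn2r ?nnegrE ?normc_ge0// invr_ge0 ltW// rho_gt0.
Qed.

Lemma pole_sum_diff_linear z : sqnorm z < 1 -> linear (pole_sum_diff a z : _ -> C^o).
Proof.
move=> z1 t x y; rewrite /pole_sum_diff.
have bx k := normc_dpole x k z1.
have b_y k := normc_dpole y k z1.
rewrite [X in _ = X + _](_ : _ =
  dyadic_meanC (fun k => t * (hdot x (a k) / (1 - hdot z (a k)) ^+ 2))); last first.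
  by rewrite (dyadic_meanCZ t bx).
pose M := normc t * ((N%:R * mxnormc x) * (rho z)^-1 ^+ 2) + (N%:R * mxnormc y) * (rho z)^-1 ^+ 2.
have M2 : 0 <= N%:R * mxnormc y * (rho z)^-1 ^+ 2 by apply: le_trans (b_y 0%N); exact: normc_ge0.
have M1 : 0 <= N%:R * mxnormc x * (rho z)^-1 ^+ 2 by apply: le_trans (bx 0%N); exact: normc_ge0.
rewrite -(@dyadic_meanCD _ _ _ M).
- congr dyadic_meanC; apply/funext => k.
  by rewrite hdotDl hdotZl mulrDl [X in _ = X + _]mulrA.
- move=> k; rewrite Normc.normcM ler_wpDr// ler_pM ?normc_ge0//.
- by move=> k; rewrite ler_wpDl// (mulr_ge0 (normc_ge0 _) M1).
Qed.

(** With u = 1 - <z, a_k> and d = <h, a_k>, each term expands as 1 / (u - d) = 1 / u + d / u^2 + d^2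
    / (u^2 (u - d)). The last part is quadratic in [h] uniformly in k, so the expansion passes
    through the mean. *)
Lemma is_diff_pole_sum z : sqnorm z < 1 ->
  is_diff z (pole_sum a : _ -> C^o) (pole_sum_diff a z).
Proof.
move=> z1; have r0 := rho_gt0 z1; set r := rho z in r0.
pose k0 : R := N%:R * r^-1 ^+ 2 + N%:R * r^-1 ^+ 2.
(* In the 4, one factor 2 comes from the denominator bound [r / 2], the other from
   [normc_dyadic_meanC]. *)
pose c0 : R := 4 * N%:R ^+ 2 * r^-1 ^+ 3.
(* Within this radius |<h, a_k>| is at most [r / 2], so the moved denominator keeps half of its
   lower bound [r]. *)
pose s0 : R := r / (2 * (N%:R + 1)).
have N0 : 0 <= N%:R :> R by [].
have s00 : 0 < s0 by rewrite divr_gt0// mulr_gt0// ltr_wpDl.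
have rV : 0 <= r^-1 by rewrite invr_ge0 ltW.
apply: (@is_diff_quadratic_remainder _ _ _ _ _ _ k0%:C c0%:C s0%:C).
- exact: pole_sum_diff_linear.
- by rewrite ler0c addr_ge0 ?mulr_ge0 ?exprn_ge0.
- by rewrite ler0c !mulr_ge0 ?exprn_ge0.
- by rewrite ltcR.
- move=> h; rewrite mxnormcE -rmorphM normcE lecR.
  apply: le_trans (normc_dyadic_meanC (fun k => normc_dpole h k z1)) _.
  by rewrite /k0 -/r mulrDl !(mulrAC _ (mxnormc h)).
move=> h; rewrite mxnormcE ltcR => hs.
rewrite -rmorphXn -rmorphM normcE lecR.
have dk k : normc (hdot h (a k)) <= r / 2.
  apply: le_trans (normc_hdot_mxnormc h (a1 k)) _.
  apply: (@le_trans _ _ ((N%:R + 1) * s0)).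
    by rewrite ler_pM ?mxnormc_ge0 ?lerDl// ltW.
  rewrite /s0 le_eqVlt; apply/orP; left; apply/eqP.
  by field; rewrite gt_eqF// ltr_wpDl.
have Bk k : r / 2 <= normc (1 - hdot (h + z) (a k)).
  rewrite hdotDl opprD addrCA addrC.
  have := normc_sub_ge (1 - hdot z (a k)) (hdot h (a k)).
  by have := dk k; have := normc_pole_ge z k; rewrite -/(rho z) -/r; lra.
have r20 : 0 < r / 2 by rewrite divr_gt0.
have B0 k : 1 - hdot (h + z) (a k) != 0.
  by apply/eqP => e; have := Bk k; rewrite e Normc.normc0; lra.
have Bi k : normc (1 - hdot (h + z) (a k))^-1 <= (r / 2)^-1.
  by rewrite Normc.normcV lef_pV2 ?posrE// (lt_le_trans r20).
have id k : (1 - hdot (h + z) (a k))^-1 =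
    (1 - hdot z (a k))^-1 + (hdot h (a k) / (1 - hdot z (a k)) ^+ 2 +
     hdot h (a k) ^+ 2 / (1 - hdot z (a k)) ^+ 2 / (1 - hdot (h + z) (a k))).
  have := B0 k; rewrite hdotDl; have := pole_neq0 k z1.
  move: (hdot z (a k)) (hdot h (a k)) => u d u0 ud; field.
  by apply/andP; split.
have remk k : normc (hdot h (a k) ^+ 2 / (1 - hdot z (a k)) ^+ 2 / (1 - hdot (h + z) (a k)))
    <= (N%:R * mxnormc h) ^+ 2 * r^-1 ^+ 2 * (r / 2)^-1.
  have hp := normc_hdot_mxnormc h (a1 k); have hi := normc_pole_inv k z1.
  have hp2 : normc (hdot h (a k)) ^+ 2 <= (N%:R * mxnormc h) ^+ 2.
    by apply: lerXn2r hp; rewrite nnegrE ?normc_ge0// mulr_ge0 ?mxnormc_ge0.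
  have hi2 : normc (1 - hdot z (a k))^-1 ^+ 2 <= r^-1 ^+ 2.
    by apply: lerXn2r hi; rewrite nnegrE ?normc_ge0.
  rewrite -exprVn Normc.normcM [X in X * _]Normc.normcM !normcX2.
  apply: ler_pM => //; first by rewrite mulr_ge0 ?sqr_ge0.
  - exact: normc_ge0.
  - by apply: ler_pM; rewrite ?sqr_ge0.
have Pz k := normc_pole_inv k z1.
have Ph k := normc_dpole h k z1.
have PR k : normc (hdot h (a k) / (1 - hdot z (a k)) ^+ 2 +
     hdot h (a k) ^+ 2 / (1 - hdot z (a k)) ^+ 2 / (1 - hdot (h + z) (a k))) <=
   N%:R * mxnormc h * (rho z)^-1 ^+ 2 + (N%:R * mxnormc h) ^+ 2 * r^-1 ^+ 2 * (r / 2)^-1.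
  by apply: le_trans (complex.le_normcD _ _) _; exact: lerD.
have -> : pole_sum a (h + z) = dyadic_meanC (fun k => (1 - hdot z (a k))^-1 +
    (hdot h (a k) / (1 - hdot z (a k)) ^+ 2 +
     hdot h (a k) ^+ 2 / (1 - hdot z (a k)) ^+ 2 / (1 - hdot (h + z) (a k)))).
  by congr dyadic_meanC; apply/funext => k; exact: id.
pose M := ((1 - sqnorm z) / 2)^-1 + (N%:R * mxnormc h * (rho z)^-1 ^+ 2 +
  (N%:R * mxnormc h) ^+ 2 * r^-1 ^+ 2 * (r / 2)^-1).
have Ma : 0 <= ((1 - sqnorm z) / 2)^-1 by apply: le_trans (Pz 0%N); exact: normc_ge0.
have Mb := le_trans (normc_ge0 _) (Ph 0%N).
have Mc := le_trans (normc_ge0 _) (remk 0%N).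
rewrite (@dyadic_meanCD _ _ _ M); last 2 first.
- by move=> k; rewrite ler_wpDr// addr_ge0.
- by move=> k; rewrite ler_wpDl.
rewrite (@dyadic_meanCD _ _ _ M); last 2 first.
- by move=> k; rewrite ler_wpDl// ler_wpDr.
- by move=> k; rewrite ler_wpDl// ler_wpDl.
have cancel (x y w : C) : x + (y + w) - x - y = w by ring.
rewrite /pole_sum /pole_sum_diff cancel.
apply: le_trans (normc_dyadic_meanC remk) _.
rewrite /c0 le_eqVlt; apply/orP; left; apply/eqP.
have : r != 0 by rewrite gt_eqF.
move: (mxnormc h) (r) => u v v0; field.
exact: v0.
Qed.

End Poles.
End PoleSum.

(** * Holomorphy of the principal square root on the right half plane *)

Section Sqrtc.
Local Open Scope classical_set_scope.
Variable R : realType.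
Local Notation C := (R[i]).
Local Notation normc := (@Normc.normc R).

Lemma Re_le_normc (x : C) : complex.Re x <= normc x.
Proof. by apply: le_trans (normr_Re_le_normc x); exact: ler_norm. Qed.

Lemma Re_inv (x : C) : complex.Re x^-1 = complex.Re x / normc x ^+ 2.
Proof.
by case: x => a b /=; rewrite sqr_sqrtr ?addr_ge0 ?sqr_ge0.
Qed.

Lemma Re_inv_gt0 (x : C) : 0 < complex.Re x -> 0 < complex.Re x^-1.
Proof.
move=> x0; rewrite Re_inv divr_gt0// exprn_gt0//.
exact: lt_le_trans (Re_le_normc _).
Qed.

Lemma ReD (x y : C) : complex.Re (x + y) = complex.Re x + complex.Re y.
Proof. by case: x; case: y. Qed.

Lemma ReN (x : C) : complex.Re (- x) = - complex.Re x.
Proof. by case: x. Qed.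

Lemma ReMn (x : C) k : complex.Re (x *+ k) = complex.Re x *+ k.
Proof. by elim: k => [|k ih]; rewrite ?mulr0n// !mulrS ReD ih. Qed.

Lemma Re_sqrtc_ge0 (x : C) : 0 <= complex.Re (sqrtc x).
Proof. by case: x => a b; exact: sqrtr_ge0. Qed.

Lemma Re_sqrtc_gt0 (x : C) : 0 < complex.Re x -> 0 < complex.Re (sqrtc x).
Proof.
case: x => a b /= a0; rewrite sqrtr_gt0 divr_gt0// ltr_wpDl// sqrtr_ge0.
Qed.

(** For roots s of x and t of x + h, the error of the linear part is exactly - h^2 / (2 s (t +
    s)^2). The principal root has nonnegative real part everywhere, so |t + s| is at least Re s > 0
    for every [h], even across the cut; the radius 1 is arbitrary. *)
Lemma differentiable_sqrtc (x : C) : 0 < complex.Re x ->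
  differentiable (@sqrtc R : C^o -> C^o) x.
Proof.
move=> x0; set s := sqrtc x.
have s0 : 0 < complex.Re s by exact: Re_sqrtc_gt0.
have sn0 : s != 0 by apply: contraTN s0 => /eqP ->; rewrite ltxx.
pose k := normc (2 * s)^-1.
pose c := normc (2 * s)^-1 * (complex.Re s)^-1 ^+ 2.
suff h : is_diff (x : C^o) (@sqrtc R : C^o -> C^o) (fun h : C^o => (2 * s)^-1 * h) by exact: ex_diff.
apply: (@is_diff_quadratic_remainder _ C^o C^o _ _ _ k%:C c%:C 1%:C).
- by move=> a u v; rewrite mulrDr mulrCA.
- by rewrite ler0c normc_ge0.
- by rewrite ler0c mulr_ge0 ?normc_ge0 ?sqr_ge0.
- exact: ltr01.
- by move=> h; rewrite !normcE -rmorphM lecR Normc.normcM.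
move=> h _; set t := sqrtc (h + x).
have ts0 : complex.Re s <= complex.Re (t + s) by rewrite ReD lerDr Re_sqrtc_ge0.
have tsn : complex.Re s <= normc (t + s) by apply: le_trans (Re_le_normc _).
have tsn0 : t + s != 0.
  by apply: contraTN s0 => /eqP e; rewrite -leNgt (le_trans tsn)// e Normc.normc0.
have hE : h = (t - s) * (t + s).
  have -> : (t - s) * (t + s) = t ^+ 2 - s ^+ 2 by ring.
  by rewrite !sqr_sqrtc addrK.
have -> : t - s - (2 * s)^-1 * h = - ((2 * s)^-1 * (t + s)^-1 ^+ 2 * h ^+ 2).
  rewrite hE; field.
  by apply/andP; split.
rewrite normrN normcE [X in _ <= _ * X ^+ 2]normcE -rmorphXn -rmorphM lecR.
rewrite Normc.normcM normcX2 ler_wpM2r ?sqr_ge0// Normc.normcM ler_wpM2l ?normc_ge0//.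
rewrite normcX2 Normc.normcV.
by apply: lerXn2r; rewrite ?nnegrE ?invr_ge0 ?normc_ge0 ?(ltW s0)// lef_pV2 ?posrE// (lt_le_trans s0).
Qed.

End Sqrtc.

(** Reading [wild_pot] as the inverse square of [wild], this transfers vanishing of the derivative
    between the two, with no formula for the derivative of the root. *)
Lemma diff_inv_sqr (K : numFieldType) (V : normedModType K) (f : V -> K^o) (z v : V) :
  differentiable f z -> f z != 0 ->
  'd (fun y => (f y ^+ 2)^-1 : K^o) z v = - 2 * (f z ^- 3) * 'd f z v.
Proof.
move=> df f0.
have d2 : differentiable (f ^+ 2) z by exact: differentiableX.
have -> : (fun y => (f y ^+ 2)^-1 : K^o) = (fun y => ((f ^+ 2) y)^-1).
  by apply/funext => y; rewrite exprfctE.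
have w2 : (f ^+ 2) z != 0 by rewrite exprfctE expf_neq0.
rewrite (diffV d2 w2) /= (diffX 1 df) /= exprfctE /= /GRing.scale /=.
by field.
Qed.

(** * The wild function: size near the sphere, derivatives at 0 and at [e / 2] *)

Section WildFunction.
Local Open Scope classical_set_scope.
Variable R : realType.
Local Notation C := (R[i]).
Local Notation normc := (@Normc.normc R).
Variables (N : nat) (a : nat -> 'rV[C]_N) (e : 'rV[C]_N).
Hypothesis a1 : forall k, sqnorm (a k) <= 1.
Hypothesis e1 : sqnorm e = 1.

(* The heavy pole pair at [e] only serves to make the derivative at [e / 2] nonzero. *)
Definition half_wild_pot (z : 'rV[C]_N) : C :=
  8 * pole_sum (fun=> e) z + pole_sum a z.
Definition wild_pot (z : 'rV[C]_N) : C := 1 + (half_wild_pot z + half_wild_pot (- z)).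
Definition wild (z : 'rV[C]_N) : C := (sqrtc (wild_pot z))^-1.

Let e1' (k : nat) : sqnorm e <= 1. Proof. by rewrite e1. Qed.

Lemma sqnormN (z : 'rV[C]_N) : sqnorm (- z) = sqnorm z.
Proof. by apply: eq_bigr => i _; rewrite mxE normcN. Qed.

Definition half_wild_pot_diff (z h : 'rV[C]_N) : C :=
  8 * pole_sum_diff (fun=> e) z h + pole_sum_diff a z h.

Lemma is_diff_half_wild_pot z : sqnorm z < 1 ->
  is_diff z (half_wild_pot : _ -> C^o) (half_wild_pot_diff z).
Proof.
move=> z1; have h1 := is_diff_pole_sum e1' z1; have h2 := is_diff_pole_sum a1 z1.
have h3 := is_diffD (is_diffZ (8 : C) h1) h2.
exact: h3.
Qed.

Lemma is_diff_wild_pot z : sqnorm z < 1 ->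
  is_diff z (wild_pot : _ -> C^o)
    (fun h => half_wild_pot_diff z h + half_wild_pot_diff (- z) (- h)).
Proof.
move=> z1; have h1 := is_diff_half_wild_pot z1.
have z1' : sqnorm (- z) < 1 by rewrite sqnormN.
have h2 := is_diff_half_wild_pot z1'.
have hN := is_diffN (is_diff_id z).
have h3 := is_diff_comp hN h2.
have h4 := is_diffD (is_diff_cst (1 : C^o) z) (is_diffD h1 h3).
by apply: is_diff_eq h4 _; apply/funext => h; rewrite !fctE add0r.
Qed.

Lemma diff_wild_potE z v : sqnorm z < 1 -> 'd (wild_pot : _ -> C^o) z v =
  half_wild_pot_diff z v + half_wild_pot_diff (- z) (- v).
Proof.
move=> z1; have [_ dv] := is_diff_wild_pot z1.
exact: (congr1 (fun g : 'rV[C]_N -> C^o => g v) dv).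
Qed.

Lemma half_wild_pot_diffN z v : sqnorm z < 1 ->
  half_wild_pot_diff z (- v) = - half_wild_pot_diff z v.
Proof.
move=> z1; have [_ dv] := is_diff_half_wild_pot z1.
have dvE w : 'd (half_wild_pot : _ -> C^o) z w = half_wild_pot_diff z w.
  exact: (congr1 (fun g : 'rV[C]_N -> C^o => g w) dv).
by rewrite -!dvE linearN.
Qed.

Lemma Re_pole_gt0 (b z : 'rV[C]_N) : sqnorm b <= 1 -> sqnorm z < 1 ->
  0 < complex.Re (1 - hdot z b)^-1.
Proof.
move=> b1 z1; apply: Re_inv_gt0; rewrite ReD ReN.
have := normc_hdot z b1; have := Re_le_normc (hdot z b).
by rewrite [complex.Re 1]/=; lra.
Qed.

Lemma pole_sum_cst (b : 'rV[C]_N) z : pole_sum (fun=> b) z = (1 - hdot z b)^-1.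
Proof. by rewrite /pole_sum /dyadic_meanC !dyadic_mean_cst; case: _^-1. Qed.

Lemma pole_sum_diff_cst (b : 'rV[C]_N) z h :
  pole_sum_diff (fun=> b) z h = hdot h b / (1 - hdot z b) ^+ 2.
Proof. by rewrite /pole_sum_diff /dyadic_meanC !dyadic_mean_cst; case: (_ / _). Qed.

Let bRe z k : sqnorm z < 1 ->
  `|complex.Re (1 - hdot z (a k))^-1| <= ((1 - sqnorm z) / 2)^-1.
Proof.
by move=> z1; apply: le_trans (normr_Re_le_normc _) (normc_pole_inv a1 k z1).
Qed.

Lemma Re_pole_sum_ge z j : sqnorm z < 1 ->
  complex.Re (1 - hdot z (a j))^-1 / (2 ^ (j + 1))%:R <= complex.Re (pole_sum a z).
Proof.
move=> z1.
have := @dyadic_mean_ge_term _ (fun k => complex.Re (1 - hdot z (a k))^-1) _ j (fun k => bRe k z1).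
by apply => k; apply/ltW/Re_pole_gt0.
Qed.

Lemma Re_half_wild_pot_ge z j : sqnorm z < 1 ->
  complex.Re (1 - hdot z (a j))^-1 / (2 ^ (j + 1))%:R < complex.Re (half_wild_pot z).
Proof.
move=> z1; rewrite /half_wild_pot ReD ltr_pwDl ?Re_pole_sum_ge// pole_sum_cst.
have h := Re_pole_gt0 (e1' 0%N) z1.
by rewrite mulr_natl ReMn mulrn_wgt0.
Qed.

Lemma Re_half_wild_pot_gt0 z : sqnorm z < 1 -> 0 < complex.Re (half_wild_pot z).
Proof.
move=> z1; apply: lt_trans (Re_half_wild_pot_ge 0 z1).
by rewrite divr_gt0 ?Re_pole_gt0// ltr0n.
Qed.

Lemma Re_wild_pot_ge z j : sqnorm z < 1 ->
  complex.Re (1 - hdot z (a j))^-1 / (2 ^ (j + 1))%:R <= complex.Re (wild_pot z).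
Proof.
move=> z1; rewrite /wild_pot !ReD [complex.Re 1]/=.
have z1' : sqnorm (- z) < 1 by rewrite sqnormN.
apply: le_trans (ltW (Re_half_wild_pot_ge j z1)) _.
by rewrite addrCA lerDl addr_ge0// ltW// Re_half_wild_pot_gt0.
Qed.

Lemma Re_wild_pot_gt1 z : sqnorm z < 1 -> 1 < complex.Re (wild_pot z).
Proof.
move=> z1; rewrite /wild_pot !ReD [complex.Re 1]/= ltrDl.
have z1' : sqnorm (- z) < 1 by rewrite sqnormN.
by rewrite addr_gt0 ?Re_half_wild_pot_gt0.
Qed.

(** The 20 is 8 * 2 from the pole at [e] plus 2 * 2 from the mean, whose complex bound doubles. *)
Lemma normc_half_wild_pot z : sqnorm z < 1 ->
  normc (half_wild_pot z) <= 20 / (1 - sqnorm z).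
Proof.
move=> z1; apply: le_trans (complex.le_normcD _ _) _.
have h1 := normc_pole_inv e1' 0 z1.
have h2 := normc_dyadic_meanC (fun k => normc_pole_inv a1 k z1).
rewrite Normc.normcM pole_sum_cst.
have -> : normc 8 = 8.
  by apply: (@complexI R); rewrite -normcE normr_nat rmorph_nat.
have -> : 20 / (1 - sqnorm z) = 8 * ((1 - sqnorm z) / 2)^-1 +
    (((1 - sqnorm z) / 2)^-1 + ((1 - sqnorm z) / 2)^-1).
  by field; rewrite subr_eq0 gt_eqF.
by apply: lerD => //; rewrite ler_wpM2l.
Qed.

(** Two halves of 20 each, and the constant 1 absorbed into 1 / (1 - |z|^2). *)
Lemma normc_wild_pot z : sqnorm z < 1 -> normc (wild_pot z) <= 41 / (1 - sqnorm z).
Proof.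
move=> z1; have z1' : sqnorm (- z) < 1 by rewrite sqnormN.
have h1 := normc_half_wild_pot z1; have h2 := normc_half_wild_pot z1'.
rewrite sqnormN in h2; apply: le_trans (complex.le_normcD _ _) _.
rewrite Normc.normc1.
have h3 : 1 <= (1 - sqnorm z)^-1.
  by rewrite invf_ge1 ?subr_gt0// gerBl sqnorm_ge0.
have := complex.le_normcD (half_wild_pot z) (half_wild_pot (- z)).
by lra.
Qed.

Lemma wild_sqr z : normc (wild z) ^+ 2 = (normc (wild_pot z))^-1.
Proof. by rewrite -normcX2 /wild exprVn sqr_sqrtc Normc.normcV. Qed.

Lemma wild_pot_gt1 z : sqnorm z < 1 -> 1 < normc (wild_pot z).
Proof. by move=> z1; apply: lt_le_trans (Re_wild_pot_gt1 z1) (Re_le_normc _). Qed.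

Lemma normc_wild_lt1 z : sqnorm z < 1 -> normc (wild z) < 1.
Proof.
move=> z1; rewrite -(@ltr_pXn2r _ 2) ?nnegrE ?normc_ge0// wild_sqr expr1n.
by rewrite invf_lt1 ?wild_pot_gt1// (lt_trans ltr01)// wild_pot_gt1.
Qed.

Lemma wild_ge z : sqnorm z < 1 -> (1 - sqnorm z) / 41 <= normc (wild z) ^+ 2.
Proof.
move=> z1; rewrite wild_sqr -invf_div lef_pV2 ?normc_wild_pot ?posrE//.
  by rewrite divr_gt0// subr_gt0.
by rewrite (lt_trans ltr01)// wild_pot_gt1.
Qed.

Lemma wild_le z j : sqnorm z < 1 ->
  normc (wild z) ^+ 2 <= (2 ^ (j + 1))%:R / complex.Re (1 - hdot z (a j))^-1.
Proof.
move=> z1; rewrite wild_sqr -invf_div.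
have h : 0 < complex.Re (1 - hdot z (a j))^-1 / (2 ^ (j + 1))%:R.
  by rewrite divr_gt0 ?Re_pole_gt0// ltr0n expn_gt0.
rewrite lef_pV2 ?posrE//; last by rewrite (lt_trans ltr01)// wild_pot_gt1.
exact: le_trans (Re_wild_pot_ge j z1) (Re_le_normc _).
Qed.

Lemma sqrtc_wild_pot_neq0 z : sqnorm z < 1 -> sqrtc (wild_pot z) != 0.
Proof.
move=> z1; rewrite sqrtc_eq0; apply/eqP => h.
by have := Re_wild_pot_gt1 z1; rewrite h ltNge ler01.
Qed.

Lemma differentiable_wild z : sqnorm z < 1 -> differentiable (wild : _ -> C^o) z.
Proof.
move=> z1; apply: (@differentiableV _ _ (fun z => sqrtc (wild_pot z) : C^o)).
  apply: (@differentiable_comp _ _ C^o C^o wild_pot (@sqrtc R)).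
    by have := is_diff_wild_pot z1 => h; exact: ex_diff.
  by apply: differentiable_sqrtc; apply: lt_trans (Re_wild_pot_gt1 z1).
exact: sqrtc_wild_pot_neq0.
Qed.

Lemma diff_wild z v : sqnorm z < 1 ->
  'd (wild_pot : _ -> C^o) z v = - 2 * (wild z ^- 3) * 'd (wild : _ -> C^o) z v.
Proof.
move=> z1; have dw := differentiable_wild z1.
have w0 : wild z != 0 by rewrite invr_eq0 sqrtc_wild_pot_neq0.
rewrite -(diff_inv_sqr v dw w0); congr ('d _ z v).
by apply/funext => x; rewrite /wild exprVn sqr_sqrtc invrK.
Qed.

Lemma diff_wild0 v : 'd (wild : _ -> C^o) 0 v = 0.
Proof.
have z1 : sqnorm (0 : 'rV[C]_N) < 1.
  by rewrite /sqnorm big1// => i _; rewrite mxE Normc.normc0 expr0n.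
have w0 : wild 0 != 0 by rewrite invr_eq0 sqrtc_wild_pot_neq0.
have := etrans (esym (diff_wild_potE v z1)) (diff_wild v z1).
move: ('d (wild : _ -> C^o) 0 v) => D.
rewrite oppr0 half_wild_pot_diffN// => /eqP; rewrite subrr eq_sym mulf_eq0 mulf_eq0 oppr_eq0 pnatr_eq0/= invr_eq0 expf_eq0/=.
by rewrite (negbTE w0) => /eqP.
Qed.

Lemma hdot_self (z : 'rV[C]_N) : hdot z z = (sqnorm z)%:C.
Proof.
rewrite /hdot -sum_normr_sqnorm; apply: eq_bigr => i _.
by rewrite sqr_normc.
Qed.

Lemma sqnormZ (t : C) (z : 'rV[C]_N) : sqnorm (t *: z) = normc t ^+ 2 * sqnorm z.
Proof.
by rewrite /sqnorm mulr_sumr; apply: eq_bigr => i _; rewrite mxE Normc.normcM exprMn.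
Qed.

Let half_e : 'rV[C]_N := 2^-1 *: e.

Let normc_half : normc (2^-1) = 2^-1.
Proof.
by apply: (@complexI R); rewrite -normcE normfV normr_nat fmorphV rmorph_nat.
Qed.

Let sqnorm_half_e : sqnorm half_e = 4^-1.
Proof. by rewrite sqnormZ e1 mulr1 normc_half; field. Qed.

(** A zero here would be a zero of the derivative of [wild_pot]. At [e / 2] the heavy pole pair
    contributes 32 - 32 / 9 = 256 / 9 to it, the other poles at most 8 + 8 in modulus; the weight 8
    is chosen to win. *)
Lemma diff_wild_half : 'd (wild : _ -> C^o) (2^-1 *: e) e != 0.
Proof.
rewrite -/half_e.
have z1 : sqnorm half_e < 1 by rewrite sqnorm_half_e; lra.
have z1' : sqnorm (- half_e) < 1 by rewrite sqnormN.
apply/eqP => h; have := etrans (esym (diff_wild_potE e z1)) (diff_wild e z1).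
move: ('d (wild : _ -> C^o) half_e e) h => D ->; rewrite mulr0.
have he k : normc (hdot e (a k)) <= 1.
  by have := normc_hdot e (a1 k); rewrite e1; lra.
(* With |s| = 1/2 and |<e, a_k>| at most 1, every denominator has modulus at least 1/4. *)
have bd (s : C) k : normc s = 2^-1 -> normc (hdot e (a k) / (1 - hdot (s *: e) (a k)) ^+ 2) <= 4.
  move=> s2; rewrite hdotZl.
  have := normc_sub_ge 1 (s * hdot e (a k)); rewrite Normc.normcM s2 Normc.normc1 => hh.
  have h2 : 2^-1 <= normc (1 - s * hdot e (a k)) by have := he k; lra.
  have h3 : normc (1 - s * hdot e (a k))^-1 <= 2.
    by rewrite Normc.normcV -[leRHS]invrK lef_pV2 ?posrE// (lt_le_trans _ h2).
  have h4 : normc (1 - s * hdot e (a k))^-1 ^+ 2 <= 4.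
    by rewrite -[4]/(2 * 2)%:R natrM -expr2; apply: lerXn2r; rewrite ?nnegrE ?normc_ge0.
  rewrite Normc.normcM -exprVn normcX2 -[4]mul1r.
  by apply: ler_pM; rewrite ?normc_ge0 ?sqr_ge0.
have B1 : normc (pole_sum_diff a half_e e) <= 4 + 4.
  by apply: normc_dyadic_meanC => k; exact: bd.
have B2 : normc (pole_sum_diff a (- half_e) e) <= 4 + 4.
  by apply: normc_dyadic_meanC => k; rewrite /half_e -scaleNr; apply: bd; rewrite normcN.
rewrite half_wild_pot_diffN//.
rewrite /half_wild_pot_diff !pole_sum_diff_cst /half_e -scaleNr !hdotZl hdot_self e1 mulr1.
move=> E.
have n2569 : normc (256 / 9) = 256 / 9.
  apply: (@complexI R).
  by rewrite -normcE normf_div !normr_nat rmorphM fmorphV !rmorph_nat.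
rewrite -scaleNr in B2; move: E B1 B2; rewrite /half_e.
move: (pole_sum_diff a (2^-1 *: e) e) (pole_sum_diff a (- 2^-1 *: e) e) => A B E B1 B2.
have BA : B - A = 256 / 9.
  rewrite -[LHS]addr0 -[X in _ + X]E; field.
  by repeat (apply/andP; split); rewrite -?(natrB, natrD) ?pnatr_eq0.
have := complex.le_normcD B (- A).
by rewrite BA n2569 normcN; lra.
Qed.

End WildFunction.

(** * Compactness and a quantitative criterion for properness *)

Section ComplexCompactness.
Local Open Scope classical_set_scope.
Variable R : realType.
Local Notation C := (R[i]).
Local Notation normc := (@Normc.normc R).

Lemma continuous_Complex : continuous (fun p : R * R => (p.1 +i* p.2 : C^o)).
Proof.
move=> [u v]; apply/cvgrPdist_le => e e0.
have eE : e = (complex.Re e)%:C by rewrite RRe_real// gtr0_real.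
have e0' : 0 < complex.Re e by rewrite -ltcR -eE.
have e2 : 0 < complex.Re e / 2 by rewrite divr_gt0.
have h1 : \forall p \near (u, v), `|u - p.1| <= complex.Re e / 2.
  have c : (fst : R * R -> R) @ (u, v) --> u by apply: cvg_fst.
  by have /cvgrPdist_le := c; exact.
have h2 : \forall p \near (u, v), `|v - p.2| <= complex.Re e / 2.
  have c : (snd : R * R -> R) @ (u, v) --> v by apply: cvg_snd.
  by have /cvgrPdist_le := c; exact.
apply: filterS2 h1 h2 => -[p q] /= hp hq.
rewrite eE lecR; apply: le_trans (normc_le_Re_Im ((u - p) +i* (v - q))) _.
by rewrite /= [leRHS]splitr lerD.
Qed.

Lemma continuous_normc : continuous (normc : C^o -> R).
Proof.
move=> x; apply/(@cvgrPdist_le _ _ _ (nbhs (x : C^o))) => e e0.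
have e0c : 0 < e%:C by rewrite ltcR.
near=> y.
have : `|x - y| <= e%:C.
  by near: y; apply: cvgr_dist_le => //; exact: cvg_id.
rewrite normcE lecR => h.
apply: le_trans h; rewrite ler_norml normc_sub_ge andbT.
rewrite -lerN2 opprK opprB; apply: le_trans (normc_sub_ge _ _) _.
by rewrite -normcN opprB.
Unshelve. all: by end_near. Qed.

Lemma compact_normc_ball (M : R) : exists2 B : set C, compact B & forall z, normc z <= M -> B z.
Proof.
exists ((fun p : R * R => p.1 +i* p.2) @` (`[- M, M] `*` `[- M, M])).
  apply: (@continuous_compact _ C^o).
    by apply: continuous_subspaceT; exact: continuous_Complex.
  by apply: compact_setX; exact: segment_compact.
move=> [u v] zM; exists (u, v) => //; split; rewrite /= in_itv/= -ler_norml.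
  exact: le_trans (normr_Re_le_normc (u +i* v)) zM.
exact: le_trans (normr_Im_le_normc (u +i* v)) zM.
Qed.

Lemma compact_sqnorm_bounded N (A : set 'rV[C]_N) (M : R) :
  closed A -> (forall z, A z -> sqnorm z <= M ^+ 2) -> 0 <= M -> compact A.
Proof.
move=> clA AM M0; have [B cB BM] := compact_normc_ball M.
apply: subclosed_compact clA (@rV_compact C N (fun=> B) (fun=> cB)) _ => z Az i.
apply: BM; rewrite -(@ler_pXn2r _ 2) ?nnegrE ?normc_ge0//.
exact: le_trans (normc_coord _ _) (AM _ Az).
Qed.

Lemma cvg_fsum (T : Type) (F : set_system T) (FF : Filter F) (K : numFieldType)
    (V : normedModType K) (I : finType) (f : I -> T -> V) (l : I -> V) :
  (forall i, f i x @[x --> F] --> l i) -> (\sum_i f i x) @[x --> F] --> \sum_i l i.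
Proof.
move=> h; rewrite (_ : (fun x => \sum_i f i x) = \sum_i f i); last first.
  by apply/funext => x; rewrite fct_sumE.
elim/big_ind2 : _ => [|u v u' v' h1 h2|i _]; [exact: cvg_cst|exact: cvgD|exact: h].
Qed.

Lemma continuous_sqnorm N : continuous (@sqnorm R N).
Proof.
move=> z; apply: (@cvg_fsum _ (nbhs z) _ _ R^o) => i.
rewrite expr2; under eq_fun do rewrite expr2.
have c1 : (fun x : 'rV[C]_N => x 0 i : C^o) @ z --> (z 0 i : C^o).
  exact: coord_continuous.
have c := cvg_comp _ _ c1 (@continuous_normc (z 0 i)).
exact: cvgM.
Qed.

Definition contraction_form m (Z : 'M[C]_m) (x : 'rV[C]_m) : R := sqnorm x - sqnorm (x *m Z).

Lemma continuous_mulmx m : continuous (fun p : 'M[C]_m * 'rV[C]_m => p.2 *m p.1).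
Proof.
move=> [Z x].
have c1 i j : (fun p : 'M[C]_m * 'rV[C]_m => p.1 i j : C^o) @ (Z, x) --> (Z i j : C^o).
  apply: (cvg_comp fst (fun M : 'M[C]_m => M i j : C^o)); first exact: cvg_fst.
  exact: coord_continuous.
have c2 i j : (fun p : 'M[C]_m * 'rV[C]_m => p.2 i j : C^o) @ (Z, x) --> (x i j : C^o).
  apply: (cvg_comp snd (fun M : 'rV[C]_m => M i j : C^o)); first exact: cvg_snd.
  exact: coord_continuous.
have c3 j : (fun p : 'M[C]_m * 'rV[C]_m => (p.2 *m p.1) 0 j : C^o) @ (Z, x) --> ((x *m Z) 0 j : C^o).
  rewrite mxE; under eq_fun do rewrite mxE.
  by apply: (@cvg_fsum _ (nbhs (Z, x)) _ _ C^o) => i; exact: cvgM.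
apply/cvg_ballP => e e0.
suff h : \forall p \near (Z, x), forall j, ball ((x *m Z) 0 j : C^o) e ((p.2 *m p.1) 0 j).
  apply: filterS h => p hp; split => // i j; rewrite ord1; exact: hp.
apply: (@filter_forall _ _ (fun j (p : 'M[C]_m * 'rV[C]_m) =>
  ball ((x *m Z) 0 j : C^o) e ((p.2 *m p.1) 0 j)) (nbhs (Z, x))) => j.
exact: (cvg_ball (c3 j) e0).
Qed.

Lemma continuous_contraction_form m :
  continuous (fun p : 'M[C]_m * 'rV[C]_m => contraction_form p.1 p.2).
Proof.
move=> [Z x]; apply: cvgB.
  by apply: (cvg_comp snd (@sqnorm R m)); [exact: cvg_snd|exact: continuous_sqnorm].
apply: (cvg_comp (fun p : 'M[C]_m * 'rV[C]_m => p.2 *m p.1) (@sqnorm R m)).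
  exact: continuous_mulmx.
exact: continuous_sqnorm.
Qed.

Lemma sqnorm_eq0 N (x : 'rV[C]_N) : sqnorm x = 0 -> x = 0.
Proof.
move=> x0; apply/rowP => i; rewrite mxE.
have := normc_coord x i; rewrite x0 => h.
apply: Normc.eq0_normc; apply/eqP; rewrite -sqrf_eq0 eq_le h sqr_ge0//.
Qed.

Lemma adjmx_quadform m (Z : 'M[C]_m) (v : 'cV[C]_m) :
  (adjmx v *m (1%:M - Z *m adjmx Z) *m v) 0 0 = (contraction_form Z (adjmx v))%:C.
Proof.
have hsq p (y : 'rV[C]_p) : (y *m adjmx y) 0 0 = (sqnorm y)%:C.
  rewrite mxE -sum_normr_sqnorm; apply: eq_bigr => i _.
  by rewrite !mxE sqr_normc.
have vK : v = adjmx (adjmx v) by apply/matrixP => i j; rewrite !mxE conjcK.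
have adjM : adjmx (adjmx v *m Z) = adjmx Z *m v.
  apply/matrixP => i j; rewrite !mxE rmorph_sum; apply: eq_bigr => k _.
  by rewrite !mxE rmorphM /= conjcK mulrC.
rewrite mulmxBr mulmx1 mulmxBl mulmxA -mulmxA -adjM.
rewrite /contraction_form rmorphB /= -!hsq -vK.
by rewrite !mxE.
Qed.

Lemma posdef_contraction m (Z : 'M[C]_m) :
  posdef (1%:M - Z *m adjmx Z) <-> (forall x, x != 0 -> 0 < contraction_form Z x).
Proof.
have adjK p q (A : 'M[C]_(p, q)) : adjmx (adjmx A) = A.
  by apply/matrixP => i j; rewrite !mxE conjcK.
have adj0 p q : adjmx (0 : 'M[C]_(p, q)) = 0.
  by apply/matrixP => i j; rewrite !mxE conjc0.
split=> h x x0.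
  have v0 : adjmx x != 0 by apply: contra_neq x0 => e; rewrite -(adjK _ _ x) e adj0.
  by have := h _ v0; rewrite adjmx_quadform adjK ltcR.
rewrite adjmx_quadform ltcR; apply: h.
by apply: contra_neq x0 => e; rewrite -(adjK _ _ x) e adj0.
Qed.

Lemma contraction_formZ m (Z : 'M[C]_m) (t : C) x :
  contraction_form Z (t *: x) = normc t ^+ 2 * contraction_form Z x.
Proof. by rewrite /contraction_form -scalemxAl !sqnormZ mulrBr. Qed.

(** The form attains its minimum on the product of [K] with the unit sphere; it is positive there
    because [K] lies in the domain, and homogeneity extends the bound to all [x]. *)
Lemma compact_contraction_form_ge m (K : set 'M[C]_m) : compact K -> K `<=` D_III m ->
  exists2 eps : R, 0 < eps & forall Z, K Z -> forall x, eps * sqnorm x <= contraction_form Z x.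
Proof.
move=> cK KD; pose S := [set x : 'rV[C]_m | sqnorm x = 1].
have cS : compact S.
  apply: (@compact_sqnorm_bounded _ _ 1) => // [|z ->]; last by rewrite expr1n.
  apply: (@closed_comp _ _ (@sqnorm R m) [set 1]); last exact: closed_eq.
  by move=> z _; exact: continuous_sqnorm.
have normalize (x : 'rV[C]_m) : x != 0 -> exists2 t : R, 0 < t & S (t%:C *: x) /\ t ^+ 2 * sqnorm x = 1.
  move=> x0; have s0 : 0 < sqnorm x.
    by rewrite lt_neqAle sqnorm_ge0 andbT eq_sym; apply: contra_neq x0; exact: sqnorm_eq0.
  have e : (Num.sqrt (sqnorm x))^-1 ^+ 2 * sqnorm x = 1.
    by rewrite exprVn sqr_sqrtr ?sqnorm_ge0// mulVf// gt_eqF.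
  exists (Num.sqrt (sqnorm x))^-1; first by rewrite invr_gt0 sqrtr_gt0.
  split => //; rewrite /S/= sqnormZ -[RHS]e; congr (_ ^+ 2 * _).
  by apply: (@complexI R); rewrite -normcE ger0_norm// ler0c invr_ge0 sqrtr_ge0.
(* If the product is empty, no nonzero [x] occurs together with a point of [K], and any [eps] will
   do. *)
have [ne|ne] := pselect ((K `*` S) !=set0); last first.
  exists 1 => // Z KZ x; have [->|x0] := eqVneq x 0.
    have s0 : sqnorm (0 : 'rV[C]_m) = 0.
      by rewrite /sqnorm big1// => i _; rewrite mxE Normc.normc0 expr0n.
    by rewrite /contraction_form mul0mx s0 mulr0 subr0.
  by have [t _ [St _]] := normalize x x0; exfalso; apply: ne; exists (Z, t%:C *: x).
have [[Z0 x0] /set_mem [/= KZ0 Sx0] hmin] := compact_EVT_min ne (compact_setX cK cS)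
  (continuous_subspaceT (@continuous_contraction_form m)).
have x00 : x0 != 0.
  apply: contra_eq_neq (Sx0 : sqnorm x0 = 1) => ->.
  by rewrite /sqnorm big1 ?(eq_sym 0) ?oner_eq0// => i _; rewrite mxE Normc.normc0 expr0n.
exists (contraction_form Z0 x0).
  by have [_ /posdef_contraction] := KD _ KZ0; apply.
move=> Z KZ x; have [->|xn0] := eqVneq x 0.
  have s0 : sqnorm (0 : 'rV[C]_m) = 0.
    by rewrite /sqnorm big1// => i _; rewrite mxE Normc.normc0 expr0n.
  by rewrite /contraction_form mul0mx s0 mulr0 subr0.
have [t t0 [St tx]] := normalize x xn0.
have := hmin (Z, t%:C *: x) (mem_set (conj KZ St)).
rewrite /= contraction_formZ.
have -> : normc t%:C = t by apply: (@complexI R); rewrite -normcE ger0_norm// ler0c ltW.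
have t20 : 0 < t ^+ 2 by rewrite exprn_gt0.
move=> h; rewrite -(ler_pM2l t20) mulrCA tx mulr1 //.
Qed.

(** The preimage of [K] keeps a uniform gap [d] from the sphere. As [sqnorm z <= 1 - d] is a closed
    condition, limits of preimage points stay in the ball, where [F] is continuous. *)
Lemma proper_map_ball N m (F : 'rV[C]_N -> 'M[C]_m) :
  (forall z, unit_ball N z -> {for z, continuous F}) ->
  (forall z, unit_ball N z -> D_III m (F z)) ->
  (forall eps : R, 0 < eps -> exists2 d : R, 0 < d & forall z, unit_ball N z ->
     (forall x, eps * sqnorm x <= contraction_form (F z) x) -> sqnorm z <= 1 - d) ->
  proper_map (unit_ball N) (D_III m) F.
Proof.
move=> cF FD Fp; split=> // K cK KD.
have [eps eps0 Keps] := compact_contraction_form_ge cK KD.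
have [d d0 dz] := Fp _ eps0.
have Kd z : unit_ball N z -> K (F z) -> sqnorm z <= 1 - d.
  by move=> zB KFz; apply: dz => //; exact: Keps.
have clK : closed K by apply: compact_closed cK; exact: (@norm_hausdorff _ 'M[C]_m).
apply: (@compact_sqnorm_bounded _ _ 1) => // [z clz|z [zB KFz]]; last first.
  by rewrite expr1n (le_trans (Kd _ zB KFz))// gerBl ltW.
have zd : sqnorm z <= 1 - d.
  have cl : closed [set z : 'rV[C]_N | sqnorm z <= 1 - d].
    apply: (@closed_comp _ _ (@sqnorm R N) [set y | y <= 1 - d]); last exact: closed_le.
    by move=> y _; exact: continuous_sqnorm.
  apply: cl => B Bz; have [w [[wB KFw] Bw]] := clz _ Bz.
  by exists w; split => //=; exact: Kd.
have zB : unit_ball N z by apply/unit_ballE; rewrite (le_lt_trans zd)// gtrBl.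
split=> //; apply: clK => B /(cF z zB) Bz; have [w [[wB KFw] Bw]] := clz _ Bz.
by exists (F w).
Qed.

End ComplexCompactness.

(** * The block matrix: positivity and distance to the boundary *)

Section BlockMap.
Local Open Scope classical_set_scope.
Variable R : realType.
Local Notation C := (R[i]).
Local Notation normc := (@Normc.normc R).

Lemma hdotC N (x y : 'rV[C]_N) : hdot y x = conjc (hdot x y).
Proof.
by rewrite /hdot rmorph_sum; apply: eq_bigr => i _; rewrite rmorphM /= conjcK mulrC.
Qed.

Lemma hdotDr N (x y a : 'rV[C]_N) : hdot a (x + y) = hdot a x + hdot a y.
Proof. by rewrite hdotC hdotDl rmorphD /= -!hdotC. Qed.

Lemma hdotZr N t (x a : 'rV[C]_N) : hdot a (t *: x) = conjc t * hdot a x.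
Proof. by rewrite hdotC hdotZl rmorphM /= -hdotC. Qed.

Lemma hdot_delta N (x : 'rV[C]_N) i : hdot x (delta_mx 0 i) = x 0 i.
Proof.
rewrite /hdot (bigD1 i)//= mxE !eqxx conjc1 mulr1 big1 ?addr0// => j ji.
by rewrite mxE (negbTE ji) andbF conjc0 mulr0.
Qed.

Lemma sqnormD N (x y : 'rV[C]_N) :
  (sqnorm (x + y))%:C = (sqnorm x)%:C + hdot x y + hdot y x + (sqnorm y)%:C.
Proof. by rewrite -!hdot_self hdotDl !hdotDr !addrA. Qed.

Lemma sqnormD_orth N (x y : 'rV[C]_N) : hdot x y = 0 -> sqnorm (x + y) = sqnorm x + sqnorm y.
Proof.
move=> xy; apply: (@complexI R); rewrite sqnormD (hdotC x y) xy conjc0 !addr0.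
by rewrite rmorphD.
Qed.

Lemma sqnorm_delta N (i : 'I_N) : sqnorm (delta_mx 0 i : 'rV[C]_N) = 1.
Proof.
by apply: (@complexI R); rewrite -hdot_self hdot_delta mxE !eqxx.
Qed.

Definition conjmx N (x : 'rV[C]_N) : 'rV[C]_N := map_mx conjc x.

Lemma sqnorm_conjmx N (x : 'rV[C]_N) : sqnorm (conjmx x) = sqnorm x.
Proof. by apply: eq_bigr => i _; rewrite mxE normc_conjc. Qed.

Lemma mulmx_outer N (x a b : 'rV[C]_N) : x *m (a^T *m b) = hdot x (conjmx a) *: b.
Proof.
rewrite mulmxA; apply/rowP => j; rewrite !mxE big_ord1 !mxE; congr (_ * _).
by apply: eq_bigr => i _; rewrite !mxE conjcK.
Qed.

Lemma normc_sqr (z : C) : (normc z ^+ 2)%:C = z * conjc z.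
Proof. by rewrite -sqr_normc rmorphXn. Qed.

Section Block.
Variables (m : nat) (i0 i1 : 'I_m) (i01 : i0 != i1).
Let d0 : 'rV[C]_m := delta_mx 0 i0.
Let d1 : 'rV[C]_m := delta_mx 0 i1.
Implicit Types (w f : C) (u x : 'rV[C]_m).

(* Up to the [f] entry this is the Cayley transform of the polynomial embedding
   (w, z) |-> [[w - (i/2) z z^T, z], [z^T, i I]] of the Siegel domain of the ball into the
   Siegel upper half space; [u] plays the role of [z / sqrt 2]. *)
Definition block_mx3 w f u : 'M[C]_m :=
  w *: (d0^T *m d0) + (d0^T *m u + u^T *m d0) - (1 - w)^-1 *: (u^T *m u) + f *: (d1^T *m d1).

Lemma block_mx3_sym w f u : (block_mx3 w f u)^T = block_mx3 w f u.
Proof.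
rewrite /block_mx3 !raddfD /= !linearN /= !linearZ /= !trmx_mul !trmxK.
by rewrite (addrC (u^T *m d0)).
Qed.

(** The coefficient of [u] in [x *m block_mx3 w f u]. *)
Definition shear w u x : C := x 0 i0 - hdot x (conjmx u) / (1 - w).
(** The part of [x] orthogonal to the two marked axes, shifted by the multiple of the conjugate of
    [u] that completes the square in [contraction_form_block]. *)
Definition tail w u x : 'rV[C]_m :=
  (x - x 0 i0 *: d0 - x 0 i1 *: d1) +
    (shear w u x * (1 - w) / conjc (1 - w)) *: conjmx u.

Lemma mulmx_block w f u x : x *m block_mx3 w f u =
  (w * x 0 i0 + hdot x (conjmx u)) *: d0 + shear w u x *: u + (f * x 0 i1) *: d1.
Proof.
have conj_delta i : conjmx (delta_mx 0 i : 'rV[C]_m) = delta_mx 0 i.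
  by apply/rowP => j; rewrite !mxE; case: (_ && _); rewrite ?conjc1 ?conjc0.
rewrite /block_mx3 !mulmxDr mulmxN -!scalemxAr !mulmx_outer !conj_delta !hdot_delta.
rewrite /shear !scalerA; apply/rowP => j; rewrite !mxE; ring.
Qed.

(** Completing the square separates the form into three terms: the wild entry only asks |f| < 1, and
    the last coefficient becomes 1 - |z|^2 once [u] is z / sqrt 2. *)
Lemma contraction_form_block w f u x : 1 - w != 0 -> u 0 i0 = 0 -> u 0 i1 = 0 ->
  contraction_form (block_mx3 w f u) x =
    (1 - normc f ^+ 2) * normc (x 0 i1) ^+ 2 + sqnorm (tail w u x) +
    normc (shear w u x) ^+ 2 * (1 - normc w ^+ 2 - 2 * sqnorm u).
Proof.
move=> w1 u0 u1.
have i10 : i1 != i0 by rewrite eq_sym.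
have W1 : 1 - conjc w != 0 by rewrite -(conjc1 R) -rmorphB conjc_eq0.
pose x0 := x 0 i0; pose x1 := x 0 i1; pose s := hdot x (conjmx u).
pose y := x - x0 *: d0 - x1 *: d1.
have d01 : hdot d0 d1 = 0 by rewrite hdot_delta mxE (negbTE i10) andbF.
have y0 : hdot y d0 = 0.
  by rewrite hdot_delta !mxE !eqxx (negbTE i01) andbF mulr1 mulr0 subrr subr0.
have y1 : hdot y d1 = 0.
  by rewrite hdot_delta !mxE !eqxx (negbTE i10) andbF mulr1 mulr0 subr0 subrr.
have xE : x = y + (x0 *: d0 + x1 *: d1) by apply/rowP => j; rewrite !mxE; ring.
have X : sqnorm x = sqnorm y + (normc x0 ^+ 2 + normc x1 ^+ 2).
  rewrite {1}xE sqnormD_orth; last by rewrite hdotDr !hdotZr y0 y1 !mulr0 addr0.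
  by rewrite (@sqnormD_orth _ (x0 *: d0)) ?hdotZl ?hdotZr ?d01 ?mulr0// !sqnormZ !sqnorm_delta !mulr1.
have su : hdot y (conjmx u) = s.
  have cu i : u 0 i = 0 -> hdot (delta_mx 0 i) (conjmx u) = 0.
    by move=> ui; rewrite hdotC hdot_delta mxE conjcK.
  by rewrite /s xE !hdotDl !hdotZl !cu// !mulr0 !addr0.
have B : sqnorm (x *m block_mx3 w f u) =
    normc (w * x0 + s) ^+ 2 + normc (shear w u x) ^+ 2 * sqnorm u + normc (f * x1) ^+ 2.
  rewrite mulmx_block sqnormD_orth; last first.
    by rewrite hdotDl !hdotZl !hdotZr d01 hdot_delta u1 !mulr0 addr0.
  rewrite sqnormD_orth; last by rewrite hdotC hdotZl !hdotZr hdot_delta u0 !mulr0 conjc0.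
  by rewrite !sqnormZ !sqnorm_delta !mulr1.
rewrite /contraction_form X B.
have T : (sqnorm (tail w u x))%:C = (sqnorm y)%:C +
    conjc (shear w u x * (1 - w) / conjc (1 - w)) * s +
    (shear w u x * (1 - w) / conjc (1 - w)) * conjc s +
    (shear w u x * (1 - w) / conjc (1 - w)) * conjc (shear w u x * (1 - w) / conjc (1 - w)) * (sqnorm u)%:C.
  rewrite /tail sqnormD -/x0 -/x1 -/y hdotZr hdotZl su (hdotC y) su.
  by rewrite sqnormZ sqnorm_conjmx (rmorphM (real_complex R)) /= normc_sqr.
have HL (A B' D E F G H : R) : (A + (B' + D) - (E + F * G + H))%:C =
    A%:C + (B'%:C + D%:C) - (E%:C + F%:C * G%:C + H%:C).
  by rewrite rmorphB !rmorphD rmorphM.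
have HR (A B' D E F G : R) : ((1 - A) * B' + D + E * (1 - F - 2 * G))%:C =
    (1 - A%:C) * B'%:C + D%:C + E%:C * (1 - F%:C - 2 * G%:C).
  by rewrite !rmorphD !rmorphM !rmorphB rmorph1 !rmorphM rmorph_nat.
apply: (@complexI R); rewrite HL HR T.
rewrite !normc_sqr.
have cw : conjc (1 - w) = 1 - conjc w by rewrite rmorphB rmorph1.
have cd : conjc (shear w u x) = conjc x0 - conjc s / (1 - conjc w).
  by rewrite /shear -/x0 -/s rmorphB fmorph_div /= cw.
have cc : conjc (shear w u x * (1 - w) / (1 - conjc w)) =
    conjc (shear w u x) * (1 - conjc w) / (1 - w).
  by rewrite -cw fmorph_div rmorphM /= conjcK.
have cs : conjc (w * x0 + s) = conjc w * conjc x0 + conjc s by rewrite rmorphD rmorphM.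
have cf : conjc (f * x1) = conjc f * conjc x1 by rewrite rmorphM.
rewrite cw cc cs cf cd /shear -/x0 -/x1 -/s.
have {cw cd cc cs cf} := w1.
(* Each number and its conjugate are now treated as independent variables: what remains is an
   identity of rational functions. *)
move: {T HL HR X B xE su y0 y1} (sqnorm y) (sqnorm u) => {y} Y U w1'.
move: (conjc w) W1 (conjc x0) (conjc s) (conjc f) (conjc x1) => W W1 X0 S G X1.
move: x0 s x1 => x0 s x1.
by field; apply/andP; split.
Qed.

Section InBall.
Variables (w f : C) (u : 'rV[C]_m).
Hypotheses (u0 : u 0 i0 = 0) (u1 : u 0 i1 = 0) (f1 : normc f < 1).
Hypothesis wu1 : 0 < 1 - normc w ^+ 2 - 2 * sqnorm u.

Lemma block_w_neq1 : 1 - w != 0.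
Proof.
apply/eqP => /eqP; rewrite subr_eq0 => /eqP w1; move: wu1.
by rewrite -w1 Normc.normc1 expr1n subrr sub0r; have := sqnorm_ge0 u; lra.
Qed.

Let f2 : 0 < 1 - normc f ^+ 2.
Proof. by rewrite subr_gt0 -(expr1n _ 2) ltr_pXn2r ?nnegrE ?normc_ge0. Qed.

(** On a null vector all three terms vanish: the first and second leave [x] on the head axis, where
    [shear] is its remaining coordinate. *)
Lemma D_III_block : D_III m (block_mx3 w f u).
Proof.
split; first exact: block_mx3_sym.
apply/posdef_contraction => x xn0.
rewrite (contraction_form_block f x block_w_neq1 u0 u1).
have A0 : 0 <= (1 - normc f ^+ 2) * normc (x 0 i1) ^+ 2 by rewrite mulr_ge0 ?sqr_ge0 ?ltW.
have B0 := sqnorm_ge0 (tail w u x).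
have D0 : 0 <= normc (shear w u x) ^+ 2 * (1 - normc w ^+ 2 - 2 * sqnorm u).
  by rewrite mulr_ge0 ?sqr_ge0 ?(ltW wu1).
rewrite lt_neqAle !addr_ge0// andbT eq_sym; apply/eqP => E.
have {E} [EA EB ED] : [/\ (1 - normc f ^+ 2) * normc (x 0 i1) ^+ 2 = 0, sqnorm (tail w u x) = 0
   & normc (shear w u x) ^+ 2 * (1 - normc w ^+ 2 - 2 * sqnorm u) = 0] by split; lra.
have sq0 (z : C) (c : R) : 0 < c -> c * normc z ^+ 2 = 0 -> z = 0.
  move=> c0 /eqP; rewrite mulf_eq0 gt_eqF//= sqrf_eq0 => /eqP.
  exact: Normc.eq0_normc.
have x1 : x 0 i1 = 0 by exact: sq0 EA.
have sh0 : shear w u x = 0 by rewrite mulrC in ED; exact: sq0 ED.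
have := sqnorm_eq0 EB; rewrite /tail sh0 !mul0r scale0r addr0 x1 scale0r subr0 => /eqP.
rewrite subr_eq0 => /eqP xE.
have s0 : hdot x (conjmx u) = 0.
  by rewrite xE hdotZl hdotC hdot_delta mxE conjcK u0 mulr0.
move: sh0; rewrite /shear s0 mul0r subr0 => x0.
by move: xn0; rewrite xE x0 scale0r eqxx.
Qed.

(** Let delta be 1 - |w|^2 - 2 |u|^2. Two test vectors give eps <= |u|^2 + delta and eps |u|^2 <=
    delta; eliminating |u|^2 gives the bound. The second alone says nothing when [u] is 0, the first
    nothing when |u|^2 exceeds eps. *)
Lemma block_boundary_dist eps : 0 < eps ->
  (forall x, eps * sqnorm x <= contraction_form (block_mx3 w f u) x) ->
  eps ^+ 2 / (1 + eps) <= 1 - normc w ^+ 2 - 2 * sqnorm u.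
Proof.
move=> eps0 h; have w1 := block_w_neq1.
have W1 : 1 - conjc w != 0 by rewrite -(conjc1 R) -rmorphB conjc_eq0.
have i10 : i1 != i0 by rewrite eq_sym.
pose e := (1 - w) / conjc (1 - w).
have ne : normc e ^+ 2 = 1.
  rewrite /e Normc.normcM Normc.normcV normc_conjc mulfV ?expr1n//.
  by apply: contra_neq w1 => /Normc.eq0_normc.
have cuu i : u 0 i = 0 -> hdot (delta_mx 0 i) (conjmx u) = 0.
  by move=> ui; rewrite hdotC hdot_delta mxE conjcK.
(* The test vector [d0] has [shear] 1 and a [tail] of the length of [u]. *)
have H1 : eps <= sqnorm u + (1 - normc w ^+ 2 - 2 * sqnorm u).
  have := h d0; rewrite (contraction_form_block f d0 w1 u0 u1) sqnorm_delta mulr1.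
  rewrite /tail /shear cuu// mul0r subr0 !mxE !eqxx (negbTE i10) andbF !scale1r scale0r.
  rewrite subrr subr0 add0r Normc.normc0 Normc.normc1 expr0n expr1n mulr0 add0r mul1r.
  by rewrite -/e mul1r sqnormZ ne mul1r sqnorm_conjmx.
(* This vector is solved from [tail = 0] and [shear = 1], so the form takes exactly the value delta
   on it. *)
pose S : C := - e * (sqnorm u)%:C.
pose x := (1 + S / (1 - w)) *: d0 - e *: conjmx u.
have xi0 : x 0 i0 = 1 + S / (1 - w) by rewrite !mxE !eqxx mulr1 u0 conjc0 mulr0 subr0.
have xi1 : x 0 i1 = 0 by rewrite !mxE (negbTE i10) andbF mulr0 u1 conjc0 mulr0 subr0.
have xs : hdot x (conjmx u) = S.
  by rewrite /x hdotDl hdotZl cuu// mulr0 add0r -scaleNr hdotZl hdot_self sqnorm_conjmx.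
have sh : shear w u x = 1 by rewrite /shear xi0 xs addrK.
have tl : tail w u x = 0.
  rewrite /tail sh mul1r -/e xi1 scale0r subr0 xi0 /x.
  by apply/rowP => j; rewrite !mxE; ring.
have H2 : eps * sqnorm u <= 1 - normc w ^+ 2 - 2 * sqnorm u.
  have := h x; rewrite (contraction_form_block f x w1 u0 u1) tl sh xi1.
  have -> : sqnorm (0 : 'rV[C]_m) = 0.
    by rewrite /sqnorm big1// => i _; rewrite mxE Normc.normc0 expr0n.
  rewrite Normc.normc0 Normc.normc1 expr0n expr1n mulr0 !add0r mul1r.
  apply: le_trans; rewrite ler_pM2l// /x sqnormD_orth; last first.
    by rewrite hdotZl -scaleNr hdotZr cuu// !mulr0.
  by rewrite -scaleNr !sqnormZ sqnorm_conjmx normcN ne mul1r lerDr mulr_ge0 ?sqr_ge0 ?sqnorm_ge0.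
rewrite ler_pdivrMr ?addr_gt0//.
by move: (sqnorm u) (normc w ^+ 2) H1 H2 => U W H1 H2; nra.
Qed.

End InBall.
End Block.
End BlockMap.

(** * The proper map of the ball *)

Section BallMap.
Local Open Scope classical_set_scope.
Variable R : realType.
Local Notation C := (R[i]).
Local Notation normc := (@Normc.normc R).

Lemma differentiable_mx (V : normedModType C) p q (F : V -> 'M[C]_(p, q)) z :
  (forall i j, differentiable (fun x => F x i j : C^o) z) -> differentiable F z.
Proof.
move=> h.
have -> : F = \sum_(i < p) (\sum_(j < q) (fun x => (F x i j : C^o) *: delta_mx i j)).
  apply/funext => x; rewrite fct_sumE {1}(matrix_sum_delta (F x)).
  by apply: eq_bigr => i _; rewrite fct_sumE.
apply: differentiable_sum => i; apply: differentiable_sum => j.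
exact: differentiableZl.
Qed.

Variables (n m : nat) (nm : (n.+1 < m)%N).
Variable a : nat -> 'rV[C]_n.+1.
Hypothesis a1 : forall k, sqnorm (a k) <= 1.

Let m0 : (0 < m)%N. Proof. exact: leq_ltn_trans nm. Qed.
Definition head_ord : 'I_m := Ordinal m0.
Definition wild_ord : 'I_m := Ordinal nm.
Definition ball_e : 'rV[C]_n.+1 := delta_mx 0 ord0.
Definition half_sqrt : C := ((Num.sqrt 2)^-1)%:C.
(** Slot 0 is the head and slot [n.+1] is kept for [wild]; the slots between carry the other
    coordinates and any later slots stay 0. [inord j] is used only where it is faithful. *)
Definition ball_tail (z : 'rV[C]_n.+1) : 'rV[C]_m :=
  \row_j (if (0 < j < n.+1)%N then half_sqrt * z 0 (inord j) else 0).
Definition ball_map (z : 'rV[C]_n.+1) : 'M[C]_m :=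
  block_mx3 head_ord wild_ord (z 0 ord0) (wild a ball_e z) (ball_tail z).

Lemma head_wild_ord : head_ord != wild_ord.
Proof. by []. Qed.

Lemma ball_tail_head z : ball_tail z 0 head_ord = 0.
Proof. by rewrite mxE. Qed.

Lemma ball_tail_wild z : ball_tail z 0 wild_ord = 0.
Proof. by rewrite mxE /= ltnn. Qed.

Lemma sqnorm_ball_tail (z : 'rV[C]_n.+1) : 1 - normc (z 0 ord0) ^+ 2 - 2 * sqnorm (ball_tail z) = 1 - sqnorm z.
Proof.
have hs : normc half_sqrt ^+ 2 = 2^-1.
  have -> : normc half_sqrt = (Num.sqrt 2)^-1.
    by apply: (@complexI R); rewrite -normcE ger0_norm// ler0c invr_ge0 sqrtr_ge0.
  by rewrite exprVn sqr_sqrtr.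
pose G (j : nat) : R := if (0 < j)%N then 2^-1 * normc (z 0 (inord j)) ^+ 2 else 0.
have -> : sqnorm (ball_tail z) = \sum_(j < m | (j < n.+1)%N) G j.
  rewrite big_mkcond; apply: eq_bigr => j _; rewrite mxE /G.
  case: (j < n.+1)%N; rewrite ?andbT ?andbF; last by rewrite Normc.normc0 expr0n.
  by case: (0 < j)%N; rewrite ?Normc.normc0 ?expr0n// Normc.normcM exprMn hs.
rewrite -(big_ord_widen _ G (ltnW nm)) big_ord_recl {1}/G /= add0r.
rewrite /sqnorm big_ord_recl opprD addrA; congr (_ - _).
rewrite mulr_sumr; apply: eq_bigr => i _.
rewrite /G /= mulrA mulfV// mul1r; congr (normc (z 0 _) ^+ 2).
by apply/val_inj; rewrite /= inordK// ltnS ltn_ord.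
Qed.

Lemma sqnorm_ball_e : sqnorm ball_e = 1.
Proof. exact: sqnorm_delta. Qed.

Lemma ball_map_wild z : ball_map z wild_ord wild_ord = wild a ball_e z.
Proof.
have u1 := ball_tail_wild z.
rewrite /ball_map /block_mx3; move: (ball_tail z) u1 (wild a ball_e z) => u u1 f.
by rewrite !mxE !big_ord1 !mxE u1 eqxx /=; ring.
Qed.

Section AtPoint.
Variable z : 'rV[C]_n.+1.
Hypothesis z1 : sqnorm z < 1.

Let wu : 0 < 1 - normc (z 0 ord0) ^+ 2 - 2 * sqnorm (ball_tail z).
Proof. by rewrite sqnorm_ball_tail subr_gt0. Qed.

Lemma ball_coord_neq1 : 1 - z 0 ord0 != 0.
Proof. exact: block_w_neq1 wu. Qed.

Lemma D_III_ball_map : D_III m (ball_map z).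
Proof.
apply: D_III_block wu; [exact: head_wild_ord|exact: ball_tail_head|exact: ball_tail_wild|].
exact: (normc_wild_lt1 a1 sqnorm_ball_e z1).
Qed.

Lemma ball_map_boundary_dist eps : 0 < eps ->
  (forall x, eps * sqnorm x <= contraction_form (ball_map z) x) ->
  sqnorm z <= 1 - eps ^+ 2 / (1 + eps).
Proof.
move=> e0 h; rewrite lerBrDr addrC -lerBrDr -sqnorm_ball_tail.
by apply: (block_boundary_dist head_wild_ord (ball_tail_head z) (ball_tail_wild z) wu e0 h).
Qed.

Lemma differentiable_ball_map : differentiable ball_map z.
Proof.
apply: differentiable_mx => i j.
have dw : differentiable (fun x : 'rV[C]_n.+1 => x 0 ord0 : C^o) z by exact: differentiable_coord.
have dwV : differentiable (fun x : 'rV[C]_n.+1 => (1 - x 0 ord0)^-1 : C^o) z.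
  apply: (@differentiableV _ _ (fun x : 'rV[C]_n.+1 => 1 - x 0 ord0 : C^o)).
    by apply: (@differentiableB _ _ _ (cst (1 : C^o))) => //; exact: differentiable_cst.
  exact: ball_coord_neq1.
have df : differentiable (wild a ball_e : _ -> C^o) z.
  exact: (differentiable_wild a1 sqnorm_ball_e z1).
have du k : differentiable (fun x : 'rV[C]_n.+1 => ball_tail x 0 k : C^o) z.
  have -> : (fun x : 'rV[C]_n.+1 => ball_tail x 0 k : C^o) = 
     (if (0 < k < n.+1)%N then half_sqrt else 0) *: (fun x : 'rV[C]_n.+1 => x 0 (inord k) : C^o).
    by apply/funext => x; rewrite mxE fctE; case: ifP => // _; rewrite scale0r.
  by apply: differentiableZ; exact: differentiable_coord.
pose E (k l : 'I_m) : C := delta_mx (0 : 'I_1) k 0 l.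
have -> : (fun x => ball_map x i j : C^o) =
  (((fun x : 'rV[C]_n.+1 => x 0 ord0 : C^o) * cst (E head_ord i * E head_ord j : C^o)
   + (cst (E head_ord i : C^o) * (fun x => ball_tail x 0 j : C^o) +
      (fun x => ball_tail x 0 i : C^o) * cst (E head_ord j : C^o)))
   - (fun x : 'rV[C]_n.+1 => (1 - x 0 ord0)^-1 : C^o) *
      ((fun x => ball_tail x 0 i : C^o) * (fun x => ball_tail x 0 j : C^o)))
   + (wild a ball_e : _ -> C^o) * cst (E wild_ord i * E wild_ord j : C^o).
  apply/funext => x; rewrite !fctE /ball_map /block_mx3.
  move: (ball_tail x) (wild a ball_e x) => u f.
  by rewrite !mxE !big_ord1 /E !mxE.
have dc (c : C) : differentiable (cst c : 'rV[C]_n.+1 -> C^o) z by exact: differentiable_cst.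
apply: differentiableD; last exact: differentiableM.
apply: differentiableB; last by apply: differentiableM => //; exact: differentiableM.
apply: differentiableD; first exact: differentiableM.
by apply: differentiableD; exact: differentiableM.
Qed.

End AtPoint.

Lemma holomorphic_ball_map : holomorphic_on (unit_ball n.+1) ball_map.
Proof. by move=> z /unit_ballE z1; exact: differentiable_ball_map. Qed.

Lemma proper_ball_map : proper_map (unit_ball n.+1) (D_III m) ball_map.
Proof.
apply: proper_map_ball => [z zB|z /unit_ballE|eps eps0].
- by apply: differentiable_continuous; exact: holomorphic_ball_map.
- exact: D_III_ball_map.
exists (eps ^+ 2 / (1 + eps)); first by rewrite divr_gt0 ?exprn_gt0 ?addr_gt0.
by move=> z /unit_ballE z1; exact: ball_map_boundary_dist.
Qed.

Lemma ball_tail_axis (t : C) : ball_tail (t *: ball_e) = 0.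
Proof.
apply/rowP => j; rewrite !mxE; case: ifP => // /andP[j0 jn].
by rewrite ?eqxx /= -val_eqE /= inordK// gtn_eqF// !mulr0.
Qed.

Lemma ball_map_axis (t : C) : ball_map (t *: ball_e) =
  t *: delta_mx head_ord head_ord + wild a ball_e (t *: ball_e) *: delta_mx wild_ord wild_ord.
Proof.
have dd i : (delta_mx 0 i : 'rV[C]_m)^T *m (delta_mx 0 i : 'rV[C]_m) = delta_mx i i.
  by rewrite trmx_delta mul_delta_mx.
rewrite /ball_map /block_mx3 ball_tail_axis !mulmx0 trmx0 !mul0mx addr0 scaler0 subr0 addr0.
by rewrite !dd !mxE !eqxx mulr1.
Qed.

Lemma derive_ball_map_axis (t : C) : normc t < 1 ->
  'D_ball_e ball_map (t *: ball_e) =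
  delta_mx head_ord head_ord +
    'D_ball_e (wild a ball_e : _ -> C^o) (t *: ball_e) *: delta_mx wild_ord wild_ord.
Proof.
move=> t1.
have z1 : sqnorm (t *: ball_e) < 1.
  by rewrite sqnormZ sqnorm_ball_e mulr1 expr_lt1 ?normc_ge0.
have df := diff_derivable (v := ball_e) (differentiable_wild a1 sqnorm_ball_e z1).
apply: cvg_lim; first exact: (@norm_hausdorff _ 'M[C]_m).
have E : \forall h \near (0 : C^o)^', delta_mx head_ord head_ord +
  (h^-1 *: (wild a ball_e (h *: ball_e + t *: ball_e) - wild a ball_e (t *: ball_e) : C^o)) *:
   delta_mx wild_ord wild_ord =
  h^-1 *: ((ball_map \o shift (t *: ball_e)) (h *: ball_e) - ball_map (t *: ball_e)).
  near=> h; rewrite /= -scalerDl !ball_map_axis.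
  move: (wild a ball_e _) (wild a ball_e _) => A B.
  have h0 : h != 0 by near: h; exact: nbhs_dnbhs_neq.
  apply/matrixP => i j; rewrite !mxE /GRing.scale /=.
  by field.
apply: cvg_trans (near_eq_cvg E) _.
apply: cvgD; first exact: cvg_cst.
apply: cvgZr_tmp; exact: df.
Unshelve. all: by end_near. Qed.

End BallMap.

(** * Bergman metrics along the axis and failure of isometry *)

Section LeviComputation.
Local Open Scope classical_set_scope.
Variable R : realType.
Local Notation C := (R[i]).
Local Notation normc := (@Normc.normc R).

(** The second derivative of ln q at 0. Polynomials suffice since, on real lines of diagonal
    matrices, the determinant is a product of two real quadratics. *)
Definition d2_ln_poly (q : {poly R}) : R := q^`()^`().[0] / q.[0] - (q^`().[0] / q.[0]) ^+ 2.

Lemma d2_at0_ln_poly (c : R) (q : {poly R}) : 0 < q.[0] ->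
  d2_at0 (fun t => c * ln q.[t]) = c * d2_ln_poly q.
Proof.
move=> q0.
have q_near : \forall t \near (0 : R), 0 < q.[t].
  by apply: (cvgr_gt _ (@continuous_horner R q 0)).
pose g := fun t : R => c * (q.[t]^-1 * q^`().[t]).
have dlt : \forall t \near (0 : R), (fun t => c * ln q.[t])^`()%classic t = g t.
  near=> t; have qt : 0 < q.[t] by near: t.
  have h := is_deriveZ c (is_derive1_comp (is_derive1_ln qt) (is_derive_poly q t)).
  by rewrite derive1E; have [_ ->] := h.
rewrite /d2_at0 derive1E (near_eq_derive _ dlt).
have qV : is_derive (0 : R) (1 : R) (fun t => q.[t]^-1) (- q.[0] ^- 2 * q^`().[0]).
  have [dq eq] := is_derive_poly q 0.
  apply: DeriveDef; first by apply: derivableV => //; rewrite gt_eqF.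
  by rewrite deriveV ?gt_eqF// eq.
have h := is_deriveZ c (is_deriveM qV (is_derive_poly q^`() 0)).
have [_ E] := h; apply: etrans E _.
rewrite /d2_ln_poly /GRing.scale /=; field.
by rewrite gt_eqF.
Unshelve. all: by end_near. Qed.

Lemma d2_ln_polyM (p q : {poly R}) : 0 < p.[0] -> 0 < q.[0] ->
  d2_ln_poly (p * q) = d2_ln_poly p + d2_ln_poly q.
Proof.
move=> p0 q0; rewrite /d2_ln_poly !derivM !derivD !derivM !(hornerD, hornerM).
by field; rewrite !gt_eqF.
Qed.

Definition disc_poly (al be : C) : {poly R} :=
  (1 - normc al ^+ 2)%:P - (2 * complex.Re (al * conjc be))%:P * 'X - (normc be ^+ 2)%:P * 'X^2.

Lemma disc_polyE (al be : C) (t : R) : (disc_poly al be).[t] = 1 - normc (al + t%:C * be) ^+ 2.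
Proof.
rewrite /disc_poly !hornerE.
case: al be => a1 a2 [b1 b2] /=; rewrite !sqr_sqrtr ?addr_ge0 ?sqr_ge0//.
by ring.
Qed.

Lemma disc_poly0 (al be : C) : (disc_poly al be).[0] = 1 - normc al ^+ 2.
Proof. by rewrite disc_polyE mul0r addr0. Qed.

(** The directions [be] and ['i * be] together give a Laplacian, here of ln (1 - |.|^2), hence the
    Poincare density. The first-order terms are the squared real and imaginary parts of al times the
    conjugate of be, which add up to |al|^2 |be|^2. *)
Lemma d2_ln_disc (al be : C) : normc al < 1 ->
  d2_ln_poly (disc_poly al be) + d2_ln_poly (disc_poly al ('i * be)) =
  - 4 * (normc be ^+ 2 / (1 - normc al ^+ 2) ^+ 2).
Proof.
move=> al1; have h : 0 < 1 - normc al ^+ 2 by rewrite subr_gt0 expr_lt1 ?normc_ge0.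
rewrite /d2_ln_poly !disc_poly0.
have D1 b : (disc_poly al b)^`().[0] = - (2 * complex.Re (al * conjc b)).
  rewrite /disc_poly expr2 !(derivB, derivM, derivC, derivX).
  by rewrite !(hornerD, hornerN, hornerM, hornerC, hornerX); ring.
have D2 b : (disc_poly al b)^`()^`().[0] = - (2 * normc b ^+ 2).
  rewrite /disc_poly expr2 !(derivD, derivN, derivM, derivC, derivX, derivMn).
  rewrite -?polyC1.
  by rewrite !(derivC, hornerD, hornerN, hornerM, hornerC, hornerX); ring.
rewrite !D1 !D2 Normc.normcM.
have -> : normc 'i = 1 by rewrite /= expr0n expr1n add0r sqrtr1.
rewrite mul1r.
have E : complex.Re (al * conjc be) ^+ 2 + complex.Re (al * conjc ('i * be)) ^+ 2 =
    normc al ^+ 2 * normc be ^+ 2.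
  case: al be {h al1 D1 D2} => a1 a2 [b1 b2] /=; rewrite !sqr_sqrtr ?addr_ge0 ?sqr_ge0//.
  by ring.
move: h E.
move: (complex.Re (al * conjc be)) (complex.Re (al * conjc ('i * be))) => u v.
move: (normc be ^+ 2) (normc al ^+ 2) => B A h E.
have A1 : 1 - A != 0 by rewrite gt_eqF.
transitivity (- 4 * (B / (1 - A)) - 4 * ((u ^+ 2 + v ^+ 2) / (1 - A) ^+ 2)); first by field.
by rewrite E; field.
Qed.


Lemma det_two_diag m (i0 i1 : 'I_m) (al be : C) : i0 != i1 ->
  \det (1%:M - (al *: delta_mx i0 i0 + be *: delta_mx i1 i1) *m
               adjmx (al *: delta_mx i0 i0 + be *: delta_mx i1 i1)) =
  ((1 - normc al ^+ 2) * (1 - normc be ^+ 2))%:C.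
Proof.
move=> i01; pose d : 'rV[C]_m := \row_j (if j == i0 then al else if j == i1 then be else 0).
have i10 : i1 != i0 by rewrite eq_sym.
have -> : al *: delta_mx i0 i0 + be *: delta_mx i1 i1 = diag_mx d.
  apply/matrixP => i j; rewrite !mxE.
  have [->|ij] := eqVneq i j; last first.
    have nij k : (i == k) && (j == k) = false.
      by apply/negbTE; apply: contra ij => /andP[/eqP-> /eqP->].
    by rewrite !nij !mulr0 addr0.
  rewrite mulr1n !andbb; have [->|_] := eqVneq j i0.
    by rewrite (negbTE i01) mulr1 mulr0 addr0.
  by rewrite mulr0 add0r; case: (j == i1); rewrite ?mulr1 ?mulr0.
have -> : adjmx (diag_mx d) = diag_mx (conjmx d).
  apply/matrixP => i j; rewrite !mxE (eq_sym j i); have [->|_] := eqVneq i j; rewrite ?mulr1n ?mulr0n ?conjc0 //.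
rewrite mulmx_diag.
have -> : 1%:M - diag_mx (\row_j (d 0 j * conjmx d 0 j)) =
    diag_mx (\row_j (1 - d 0 j * conjc (d 0 j))).
  by apply/matrixP => i j; rewrite !mxE -mulrnBl.
have HM (A B : R) : ((1 - A) * (1 - B))%:C = (1 - A%:C) * (1 - B%:C).
  by rewrite rmorphM !rmorphB rmorph1.
rewrite det_diag (bigD1 i0)//= (bigD1 i1)//= big1 ?mulr1 => [|i /andP[n0 n1]].
  by rewrite !mxE !eqxx (negbTE i10) -!normc_sqr HM.
by rewrite !mxE (negbTE n0) (negbTE n1) mul0r subr0.
Qed.

Lemma levi_disc_ln (T : lmodType C) (phi : T -> R) (Z V : T) (k : R) (p q : {poly R}) :
  0 < p.[0] -> 0 < q.[0] ->
  (forall t : R, phi (Z + t%:C *: V) = k * ln p.[t]) ->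
  (forall t : R, phi (Z + (0 +i* t) *: V) = k * ln q.[t]) ->
  levi phi Z V = k * (d2_ln_poly p + d2_ln_poly q) / 4.
Proof.
move=> p0 q0 hp hq; rewrite /levi.
rewrite (_ : (fun t : R => phi (Z + t%:C *: V)) = (fun t => k * ln p.[t])); last exact/funext.
rewrite (_ : (fun t : R => phi (Z + (0 +i* t) *: V)) = (fun t => k * ln q.[t])); last exact/funext.
by rewrite !d2_at0_ln_poly// -mulrDr.
Qed.

Lemma imag_mul (t : R) (b : C) : (0 +i* t) * b = t%:C * ('i * b).
Proof. by rewrite mulrA; congr (_ * _); rewrite /GRing.mul /=; congr (_ +i* _); ring. Qed.

Lemma disc_poly_gt0 (al be : C) : normc al < 1 -> 0 < (disc_poly al be).[0].
Proof. by move=> h; rewrite disc_poly0 subr_gt0 expr_lt1 ?normc_ge0. Qed.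

Lemma levi_bergman_III m (i0 i1 : 'I_m) (al be a' b' : C) : i0 != i1 ->
  normc al < 1 -> normc be < 1 ->
  levi (@bergman_pot_III R m) (al *: delta_mx i0 i0 + be *: delta_mx i1 i1)
    (a' *: delta_mx i0 i0 + b' *: delta_mx i1 i1) =
  m.+1%:R * (normc a' ^+ 2 / (1 - normc al ^+ 2) ^+ 2 + normc b' ^+ 2 / (1 - normc be ^+ 2) ^+ 2).
Proof.
move=> i01 al1 be1.
pose p a b : {poly R} := disc_poly al a * disc_poly be b.
have comb (s : C) : (al *: delta_mx i0 i0 + be *: delta_mx i1 i1) +
    s *: (a' *: delta_mx i0 i0 + b' *: delta_mx i1 i1) =
    (al + s * a') *: delta_mx i0 i0 + (be + s * b') *: delta_mx i1 i1 :> 'M[C]_m.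
  by apply/matrixP => i j; rewrite !mxE; ring.
rewrite (@levi_disc_ln _ _ _ _ (- m.+1%:R) (p a' b') (p ('i * a') ('i * b'))).
- rewrite !d2_ln_polyM ?disc_poly_gt0// addrACA !d2_ln_disc//.
  by field; rewrite !gt_eqF// subr_gt0 expr_lt1 ?normc_ge0.
- by rewrite hornerM mulr_gt0 ?disc_poly_gt0.
- by rewrite hornerM mulr_gt0 ?disc_poly_gt0.
- by move=> t; rewrite /bergman_pot_III comb det_two_diag// hornerM !disc_polyE.
- by move=> t; rewrite /bergman_pot_III comb det_two_diag// hornerM !disc_polyE -!imag_mul.
Qed.

Lemma levi_bergman_ball n (t : C) : normc t < 1 ->
  levi (@bergman_pot_ball R n.+1) (t *: ball_e R n) (ball_e R n) =
  n.+2%:R / (1 - normc t ^+ 2) ^+ 2.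
Proof.
move=> t1.
have pot (s : C) : bergman_pot_ball (s *: ball_e R n) = - n.+2%:R * ln (1 - normc s ^+ 2).
  by rewrite /bergman_pot_ball sum_normr_sqnorm sqnormZ sqnorm_ball_e mulr1.
rewrite (@levi_disc_ln _ _ _ _ (- n.+2%:R) (disc_poly t 1) (disc_poly t ('i * 1))).
- rewrite d2_ln_disc// Normc.normc1 expr1n.
  by field; rewrite !gt_eqF// subr_gt0 expr_lt1 ?normc_ge0.
- exact: disc_poly_gt0.
- exact: disc_poly_gt0.
- by move=> s; rewrite -scalerDl pot disc_polyE mulr1.
- by move=> s; rewrite -scalerDl pot disc_polyE -imag_mul mulr1.
Qed.

Lemma not_isometry_ball_map n m (nm : (n.+1 < m)%N) (a : nat -> 'rV[C]_n.+1) :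
  (forall k, sqnorm (a k) <= 1) -> ~ holomorphic_isometry (ball_map nm a).
Proof.
move=> a1 [_ [lam [lam0 iso]]].
have e1 := sqnorm_ball_e R n.
have key (t : C) : normc t < 1 ->
    m.+1%:R * (1 / (1 - normc t ^+ 2) ^+ 2 +
      normc ('D_(ball_e R n) (wild a (ball_e R n) : _ -> C^o) (t *: ball_e R n)) ^+ 2 /
      (1 - normc (wild a (ball_e R n) (t *: ball_e R n)) ^+ 2) ^+ 2) =
    lam * (n.+2%:R / (1 - normc t ^+ 2) ^+ 2).
  move=> t1.
  have z1 : sqnorm (t *: ball_e R n) < 1 by rewrite sqnormZ e1 mulr1 expr_lt1 ?normc_ge0.
  have := iso (t *: ball_e R n) (ball_e R n) ((unit_ballE _).2 z1).
  have := derive_ball_map_axis nm a1 t1; rewrite -[delta_mx (head_ord nm) _]scale1r => ->.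
  rewrite ball_map_axis levi_bergman_ball// => <-.
  rewrite levi_bergman_III ?head_wild_ord//; last exact: normc_wild_lt1.
  by rewrite Normc.normc1 expr1n.
have D0 : 'D_(ball_e R n) (wild a (ball_e R n) : _ -> C^o) ((0 : C) *: ball_e R n) = 0.
  rewrite scale0r deriveE; first exact: diff_wild0.
  apply: differentiable_wild => //.
  by rewrite /sqnorm big1// => i _; rewrite mxE Normc.normc0 expr0n.
have n0 : normc (0 : C) < 1 by rewrite Normc.normc0.
have nh : normc (2^-1 : C) = 2^-1.
  by apply: (@complexI R); rewrite -normcE normfV normr_nat fmorphV rmorph_nat.
have nh1 : normc (2^-1 : C) < 1 by rewrite nh; lra.
(* At 0 the wild term drops out, which fixes [lam] through [m.+1 = lam * n.+2]. At 1/2 this value of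
   [lam] leaves no room for the wild term. *)
have := key 0 n0; rewrite D0 Normc.normc0 expr0n /= mul0r addr0 subr0 expr1n divr1 mulr1.
rewrite divr1 => mlam.
have := key _ nh1; rewrite mulrA -mlam.
have z1 : sqnorm (2^-1 *: ball_e R n : 'rV[C]_n.+1) < 1.
  by rewrite sqnormZ e1 mulr1 expr_lt1 ?normc_ge0.
have Dn : 'D_(ball_e R n) (wild a (ball_e R n) : _ -> C^o) ((2^-1 : C) *: ball_e R n) != 0.
  rewrite deriveE; last exact: differentiable_wild.
  exact: diff_wild_half.
have w1 := normc_wild_lt1 a1 e1 z1.
move: ('D_(ball_e R n) _ _) (wild a _ _) Dn w1 => D w Dn w1.
rewrite mulrDr mul1r -[RHS]addr0 => /addrI/eqP.
rewrite mulf_eq0 pnatr_eq0 /= mulf_eq0 invr_eq0 !expf_eq0 /= => /orP[/eqP/Normc.eq0_normc D00|].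
  by rewrite D00 eqxx in Dn.
by rewrite gt_eqF// subr_gt0 expr_lt1 ?normc_ge0.
Qed.

End LeviComputation.

(** * A dense sequence on the sphere and a one-variable lemma *)

Section NonExtension.
Local Open Scope classical_set_scope.
Variable R : realType.
Local Notation C := (R[i]).
Local Notation normc := (@Normc.normc R).

Definition rsqnorm N (v : 'rV[R]_N) : R := \sum_i v 0 i ^+ 2.

Lemma rsqnorm_ge0 N (v : 'rV[R]_N) : 0 <= rsqnorm v.
Proof. by apply: sumr_ge0 => i _; exact: sqr_ge0. Qed.

Lemma rsqnormZ N t (v : 'rV[R]_N) : rsqnorm (t *: v) = t ^+ 2 * rsqnorm v.
Proof. by rewrite /rsqnorm mulr_sumr; apply: eq_bigr => i _; rewrite mxE exprMn. Qed.

Lemma rsqnorm_eq0 N (v : 'rV[R]_N) : rsqnorm v = 0 -> v = 0.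
Proof.
move=> v0; apply/rowP => i; rewrite mxE; apply/eqP; rewrite -sqrf_eq0 eq_le sqr_ge0 andbT -v0.
by rewrite /rsqnorm (bigD1 i)//= lerDl sumr_ge0// => j _; rewrite sqr_ge0.
Qed.

Lemma sqnorm_realify n (v : 'rV[R]_(n + n)) : sqnorm (realify v) = rsqnorm v.
Proof.
rewrite /sqnorm /rsqnorm big_split_ord /= -big_split /=; apply: eq_bigr => i _ /=.
by rewrite !mxE /= sqr_sqrtr ?addr_ge0 ?sqr_ge0.
Qed.

Lemma Re_hdot_realify n (u v : 'rV[R]_(n + n)) :
  complex.Re (hdot (realify u) (realify v)) = \sum_i u 0 i * v 0 i.
Proof.
have Re_sum (F : 'I_n -> C) : complex.Re (\sum_i F i) = \sum_i complex.Re (F i).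
  by elim/big_ind2 : _ => // a b c d <- <-; exact: ReD.
rewrite /hdot Re_sum big_split_ord /= -big_split /=; apply: eq_bigr => i _ /=.
by rewrite !mxE /=; ring.
Qed.

Lemma realifyD n (u v : 'rV[R]_(n + n)) : realify (u + v) = realify u + realify v.
Proof. by apply/rowP => i; rewrite !mxE. Qed.

Lemma realifyZ n t (u : 'rV[R]_(n + n)) : realify (t *: u) = t%:C *: realify u.
Proof. by apply/rowP => i; rewrite !mxE; congr (_ +i* _); rewrite ?mul0r ?subr0 ?addr0. Qed.

Definition normalize N (v : 'rV[R]_N) : 'rV[R]_N := (Num.sqrt (rsqnorm v))^-1 *: v.

Lemma rsqnorm_normalize N (v : 'rV[R]_N) : v != 0 -> rsqnorm (normalize v) = 1.
Proof.
move=> v0; rewrite rsqnormZ exprVn sqr_sqrtr ?rsqnorm_ge0// mulVf//.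
by apply: contra_neq v0; exact: rsqnorm_eq0.
Qed.

(** Poles must lie exactly on the sphere, so rational vectors are projected radially. A code that is
    invalid or decodes to the zero vector yields 0, whose pole term is the constant 1; hence the
    assumption on poles is [sqnorm (a k) <= 1] rather than equality. *)
Definition rational_direction N (k : nat) : 'rV[R]_N :=
  if @unpickle 'rV[rat]_N k is Some q then normalize (map_mx ratr q) else 0.

Lemma rsqnorm_rational_direction_le1 N k : rsqnorm (rational_direction N k) <= 1.
Proof.
have n0 : rsqnorm (0 : 'rV[R]_N) = 0.
  by rewrite /rsqnorm big1// => i _; rewrite mxE expr0n.
rewrite /rational_direction; case: unpickle => [q|]; last by rewrite n0.
have [->|q0] := eqVneq (map_mx ratr q : 'rV[R]_N) 0; last by rewrite rsqnorm_normalize.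
by rewrite /normalize scaler0 n0.
Qed.

(** Radial projection is continuous at [v] and fixes it, so rational vectors close to [v] project
    into [W]. *)
Lemma dense_rational_direction N (W : set 'rV[R]_N) (v : 'rV[R]_N) :
  open W -> W v -> rsqnorm v = 1 ->
  exists k, W (rational_direction N k) /\ rsqnorm (rational_direction N k) = 1.
Proof.
move=> oW Wv v1.
have crs : rsqnorm x @[x --> v] --> rsqnorm v.
  apply: (@cvg_fsum _ (nbhs v) _ _ R^o) => i.
  rewrite expr2; under eq_fun do rewrite expr2.
  by apply: cvgM; exact: coord_continuous.
have cn : normalize x @[x --> v] --> normalize v.
  have cs := cvg_comp _ _ crs (@sqrt_continuous R (rsqnorm v)).
  have sn : Num.sqrt (rsqnorm v) != 0 by rewrite v1 sqrtr1 oner_eq0.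
  have cV : (Num.sqrt (rsqnorm x))^-1 @[x --> v] --> (Num.sqrt (rsqnorm v))^-1.
    exact: (cvgV sn cs).
  have ci : (id : 'rV[R]_N -> 'rV[R]_N) @ v --> v by apply: cvg_id.
  exact: (cvgZ cV ci).
have nv : normalize v = v by rewrite /normalize v1 sqrtr1 invr1 scale1r.
rewrite nv in cn.
have near1 : \forall x \near v, W (normalize x) by apply: cn; exact: open_nbhs_nbhs.
have near2 : \forall x \near v, 0 < rsqnorm x by apply: (cvgr_gt _ crs); rewrite v1.
have [e e0 he] := (nbhs_ballP _ _).1 (filterI near1 near2).
have hq i : exists q : rat, v 0 i - e < ratr q < v 0 i + e.
  have lt : v 0 i - e < v 0 i + e by rewrite /= in e0; lra.
  by have [q] := rat_in_itvoo lt; exists q.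
pose q : 'rV[rat]_N := \row_i xchoose (hq i).
have [] : W (normalize (map_mx ratr q)) /\ 0 < rsqnorm (map_mx ratr q : 'rV[R]_N).
  apply: he; split => // i j; rewrite ord1 /ball/= !mxE.
  have := xchooseP (hq j); rewrite ltr_norml => /andP[h1 h2].
  by apply/andP; split; lra.
move=> Wq q0; exists (pickle q); rewrite /rational_direction pickleK; split => //.
apply: rsqnorm_normalize; apply: contraTneq q0 => ->.
by rewrite /rsqnorm big1 ?ltxx// => i _; rewrite mxE expr0n.
Qed.

(* The square-root bound forces [g 0 = 0]. *)
Lemma derivable_quadratic_bound (g : R -> R) (s K d : R) :
  cvg (h^-1 *: (g h - g 0 : R^o) @[h --> 0^']) -> s != 0 -> 0 < d ->
  (forall t, 0 < t -> t < d -> g (s * t) ^+ 2 <= K * t) ->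
  exists M, exists2 d', 0 < d' & forall t, 0 < t -> t < d' -> g (s * t) ^+ 2 <= M * t ^+ 2.
Proof.
move=> /cvg_ex[l hl] s0 d0 gK.
have B : \forall h \near 0^', `|h^-1 * (g h - g 0)| <= `|l| + 1.
  by apply: (cvgr_norm_le l hl); rewrite ltrDl.
have [e /= e0 he] := B.
set b := `|l| + 1 in he.
have sn0 : 0 < `|s| by rewrite normr_gt0.
have b0 : 0 < b by rewrite ltr_wpDl.
pose d1 := Num.min d (e / `|s|).
have d10 : 0 < d1 by rewrite lt_min d0 divr_gt0.
have gb t : 0 < t -> t < d1 -> (g (s * t) - g 0) ^+ 2 <= (b * `|s|) ^+ 2 * t ^+ 2.
  move=> t0; rewrite lt_min => /andP[_ te].
  have st0 : s * t != 0 by rewrite mulf_neq0// gt_eqF.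
  have := he (s * t); rewrite /= sub0r normrN normrM (gtr0_norm t0) -ltr_pdivlMl// mulrC => /(_ te st0).
  rewrite normrM normfV ler_pdivrMl ?normr_gt0// => h.
  rewrite -real_normK ?num_real// -exprMn; apply: lerXn2r; rewrite ?nnegrE ?normr_ge0//.
    by rewrite !mulr_ge0 ?ltW.
  by apply: le_trans h _; rewrite normrM (gtr0_norm t0) mulrC mulrA.
pose L := 2 * K + 2 * (b * `|s|) ^+ 2.
have g0L t : 0 < t -> t < Num.min d1 1 -> g 0 ^+ 2 <= L * t.
  move=> t0; rewrite lt_min => /andP[td1 t1].
  have td : t < d by move: td1; rewrite lt_min => /andP[].
  have h1 := gb t t0 td1; have h2 := gK t t0 td.
  have h3 : (b * `|s|) ^+ 2 * t ^+ 2 <= (b * `|s|) ^+ 2 * t.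
    by rewrite ler_wpM2l ?sqr_ge0// expr2 ler_piMl// ltW.
  (* For u = g(s t) and v = g(0), (2 u - v)^2 >= 0 amounts to v^2 <= 2 u^2 + 2 (u - v)^2, which is
     where [L] comes from. *)
  have h4 := sqr_ge0 (g (s * t) + (g (s * t) - g 0)).
  by rewrite /L; move: (g (s * t)) (g 0) ((b * `|s|) ^+ 2) h1 h2 h3 h4 => u v w h1 h2 h3 h4; nra.
have g00 : g 0 = 0.
  apply/eqP; rewrite -sqrf_eq0; apply/negPn/negP => gn0.
  have gp : 0 < g 0 ^+ 2 by rewrite lt_neqAle sqr_ge0 andbT eq_sym.
  have m0 : 0 < Num.min d1 1 by rewrite lt_min d10 ltr01.
  have Lp : 0 < L.
    have := g0L (Num.min d1 1 / 2); rewrite divr_gt0// ltr_pdivrMr// ltr_pMr// ltr1n => /(_ isT isT) h.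
    by have := lt_le_trans gp h; rewrite pmulr_lgt0// divr_gt0.
  pose t := Num.min (Num.min d1 1 / 2) (g 0 ^+ 2 / (2 * L)).
  have t0 : 0 < t by rewrite lt_min !divr_gt0// mulr_gt0.
  have tm : t < Num.min d1 1.
    by rewrite gt_min; apply/orP; left; rewrite ltr_pdivrMr// ltr_pMr// ltr1n.
  have := g0L t t0 tm; apply/negP; rewrite -ltNge.
  have : t <= g 0 ^+ 2 / (2 * L) by rewrite ge_min lexx orbT.
  rewrite ler_pdivlMr ?mulr_gt0// => h; lra.
exists ((b * `|s|) ^+ 2); exists d1 => // t t0 td1.
by have := gb t t0 td1; rewrite g00 subr0.
Qed.

End NonExtension.

(** * No smooth extension across any boundary piece *)

Section NoSmoothExtension.
Local Open Scope classical_set_scope.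
Variable R : realType.
Local Notation C := (R[i]).
Local Notation normc := (@Normc.normc R).
Variables (n m : nat) (nm : (n.+1 < m)%N).

Let dir (k : nat) : 'rV[R]_(n.+1 + n.+1) := rational_direction R (n.+1 + n.+1) k.
Definition sphere_poles (k : nat) : 'rV[C]_n.+1 := realify (dir k).

Lemma sqnorm_sphere_poles k : sqnorm (sphere_poles k) <= 1.
Proof. by rewrite sqnorm_realify rsqnorm_rational_direction_le1. Qed.

Lemma sum_ebasis N (i : 'I_N) (x : 'rV[R]_N) h : \sum_j (h *: ebasis R i) 0 j * x 0 j = h * x 0 i.
Proof.
rewrite (bigD1 i)//= big1 => [|j ji]; first by rewrite !mxE !eqxx mulr1 addr0.
by rewrite !mxE (negbTE ji) andbF mulr0 mul0r.
Qed.

Lemma rsqnorm_ebasis_add N (i : 'I_N) (x : 'rV[R]_N) h :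
  rsqnorm (h *: ebasis R i + x) = rsqnorm x + 2 * h * x 0 i + h ^+ 2.
Proof.
have -> : rsqnorm (h *: ebasis R i + x) = \sum_j ((h *: ebasis R i) 0 j * (h *: ebasis R i) 0 j
    + ((h *: ebasis R i) 0 j * x 0 j + (h *: ebasis R i) 0 j * x 0 j) + x 0 j ^+ 2).
  by apply: eq_bigr => j _; rewrite mxE; ring.
rewrite !big_split /= !sum_ebasis -/(rsqnorm x) !mxE !eqxx /=; ring.
Qed.

Section Approach.
Variables (k : nat) (i : 'I_(n.+1 + n.+1)).
Let x := dir k.
Hypothesis x1 : rsqnorm x = 1.
Let c := x 0 i.
Hypothesis c0 : c != 0.
(** A coordinate line, since [C2_on] speaks of partial derivatives. It is transversal because [c] is
    nonzero, and the speed [- c] puts small t > 0 inside the ball whatever the sign of [c]. *)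
Let pt (t : R) : 'rV[R]_(n.+1 + n.+1) := (- c * t) *: ebasis R i + x.
Let f (t : R) : C := wild sphere_poles (ball_e R n) (realify (pt t)).

Let c2 : 0 < c ^+ 2.
Proof. by rewrite lt_neqAle sqr_ge0 andbT eq_sym sqrf_eq0. Qed.

Let rpt t : rsqnorm (pt t) = 1 - c ^+ 2 * t * (2 - t).
Proof. by rewrite rsqnorm_ebasis_add x1 -/c; ring. Qed.

Lemma approach_in_ball t : 0 < t -> t < 1 -> sqnorm (realify (pt t)) < 1.
Proof.
move=> t0 t1; rewrite sqnorm_realify rpt ltrBlDr ltrDl.
by apply: mulr_gt0; [exact: mulr_gt0|lra].
Qed.

Lemma wild_approach_ge t : 0 < t -> t < 1 -> c ^+ 2 / 41 * t <= normc (f t) ^+ 2.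
Proof.
move=> t0 t1.
have := wild_ge sqnorm_sphere_poles (sqnorm_ball_e R n) (approach_in_ball t0 t1).
apply: le_trans; rewrite sqnorm_realify rpt mulrAC ler_pM2r ?invr_gt0//.
have : c ^+ 2 * t * 1 <= c ^+ 2 * t * (2 - t) by apply: ler_wpM2l; [apply/ltW; exact: mulr_gt0|lra].
by lra.
Qed.

(** As <x, x> = 1, the pole denominator at [pt t] is exactly t beta, and Re (1 / (t beta)) = c^2 /
    (t |beta|^2). *)
Let beta : C := c%:C * hdot (realify (ebasis R i)) (realify x).

Let Re_beta : complex.Re beta = c ^+ 2.
Proof.
have := Re_hdot_realify (1 *: ebasis R i) x.
rewrite sum_ebasis mul1r scale1r -/c /beta.
by case: (hdot _ _) => u v /= ->; rewrite mul0r subr0 expr2.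
Qed.

Lemma wild_approach_le t : 0 < t -> t < 1 ->
  normc (f t) ^+ 2 <= (2 ^ (k + 1))%:R * normc beta ^+ 2 / c ^+ 2 * t.
Proof.
move=> t0 t1.
have := wild_le sqnorm_sphere_poles (sqnorm_ball_e R n) k (approach_in_ball t0 t1).
move=> /le_trans; apply.
have hx : hdot (realify x) (realify x) = 1.
  by rewrite hdot_self sqnorm_realify x1.
have -> : 1 - hdot (realify (pt t)) (sphere_poles k) = t%:C * beta.
  rewrite /pt realifyD realifyZ hdotDl hdotZl /sphere_poles -/x hx /beta.
  by rewrite !(rmorphM (real_complex R)) /= !(rmorphN (real_complex R)) /=; ring.
have tb : complex.Re (t%:C * beta) = t * c ^+ 2.
  by rewrite -Re_beta; case: beta => u v /=; rewrite mul0r subr0.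
have nt : normc t%:C = t.
  by apply: (@complexI R); rewrite -normcE ger0_norm// ler0c ltW.
have nb : 0 < normc beta.
  by apply: lt_le_trans (Re_le_normc beta); rewrite Re_beta.
rewrite Re_inv tb Normc.normcM nt le_eqVlt; apply/orP; left; apply/eqP.
have := gt_eqF t0; have := gt_eqF nb; move=> /negbT nb0 /negbT t00.
by field; rewrite ?nb0 ?t00 ?c0.
Qed.

End Approach.

(** On the line through a pole in [W], the wild entry of an extension would have real and imaginary
    parts differentiable at 0, so its squared modulus would be O(t^2), against the lower bound c^2 t
    / 41. *)
Lemma ball_map_not_C2 : ~ C2_extends_to_boundary_piece (ball_map nm sphere_poles).
Proof.
move=> [W [G [oW [v [Wv /unit_sphereE vS]] C2G Gext]]].
rewrite sqnorm_realify in vS.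
have [k [Wx x1]] := dense_rational_direction oW Wv vS.
set x := rational_direction _ _ _ in Wx x1.
have [i c0] : exists i, x 0 i != 0.
  apply/not_existsP => h; have : rsqnorm x = 0.
    by rewrite /rsqnorm big1// => j _; have /negP := h j; rewrite negbK => /eqP ->; rewrite expr0n.
  by rewrite x1 => /eqP; rewrite oner_eq0.
set c := x 0 i in c0.
pose j := wild_ord nm.
pose g h := G (h *: ebasis R i + x) j j.
have [C2R C2I] := C2G j j.
have [_ /(_ i i) [dR _ _ _]] := C2R x Wx.
have [_ /(_ i i) [dI _ _ _]] := C2I x Wx.
have g0 : G x j j = g 0 by rewrite /g scale0r add0r.
have {}dR : cvg (h^-1 *: (complex.Re (g h) - complex.Re (g 0) : R^o) @[h --> 0^']).
  by move: dR; rewrite /derivable g0.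
have {}dI : cvg (h^-1 *: (complex.Im (g h) - complex.Im (g 0) : R^o) @[h --> 0^']).
  by move: dI; rewrite /derivable g0.
have [d /= d0 dW] : \forall h \near (0 : R), W (h *: ebasis R i + x).
  have cv : (h *: ebasis R i + x) @[h --> (0 : R)] --> (0 : R) *: ebasis R i + x.
    by apply: cvgD; [apply: cvgZr_tmp; exact: cvg_id|exact: cvg_cst].
  by apply: cv; rewrite scale0r add0r; exact: open_nbhs_nbhs.
have cn0 : 0 < `|c| by rewrite normr_gt0.
pose d1 := Num.min 1 (d / `|c|).
have d10 : 0 < d1 by rewrite lt_min ltr01 divr_gt0.
have gE t : 0 < t -> t < d1 ->
    g (- c * t) = wild sphere_poles (ball_e R n) (realify ((- c * t) *: ebasis R i + x)).
  move=> t0; rewrite lt_min => /andP[t1 td].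
  rewrite /g Gext; first exact: ball_map_wild.
    apply: dW; rewrite /= sub0r normrN normrM normrN (gtr0_norm t0).
    by rewrite -ltr_pdivlMl// mulrC.
  by apply/unit_ballE; exact: (approach_in_ball x1 c0 t0 t1).
pose K := (2 ^ (k + 1))%:R * normc (c%:C * hdot (realify (ebasis R i)) (realify x)) ^+ 2 / c ^+ 2.
have gK t : 0 < t -> t < d1 -> normc (g (- c * t)) ^+ 2 <= K * t.
  move=> t0 td; rewrite gE//; apply: (wild_approach_le x1 c0) => //.
  by move: td; rewrite lt_min => /andP[].
have cN0 : - c != 0 by rewrite oppr_eq0.
have sqle (u w : R) : `|u| <= w -> u ^+ 2 <= w ^+ 2.
  move=> h; rewrite -real_normK ?num_real//; apply: lerXn2r; rewrite ?nnegrE//.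
  exact: le_trans h.
have [M1 [e1 e10 h1]] := @derivable_quadratic_bound _ (fun h => complex.Re (g h)) _ K d1 dR cN0 d10
  (fun t t0 td => le_trans (sqle _ _ (normr_Re_le_normc _)) (gK t t0 td)).
have [M2 [e2 e20 h2]] := @derivable_quadratic_bound _ (fun h => complex.Im (g h)) _ K d1 dI cN0 d10
  (fun t t0 td => le_trans (sqle _ _ (normr_Im_le_normc _)) (gK t t0 td)).
have c2 : 0 < c ^+ 2 by rewrite lt_neqAle sqr_ge0 andbT eq_sym sqrf_eq0.
pose D := Num.min d1 (Num.min e1 e2).
have D0 : 0 < D.
  by rewrite lt_min; apply/andP; split => //; rewrite lt_min; apply/andP.
have M0 : 0 < 41 * (`|M1 + M2| + 1) by rewrite mulr_gt0// ltr_wpDl.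
(* Small enough that 41 |M1 + M2| t < c^2, which contradicts the two bounds after division by
   [t]. *)
pose t := Num.min (D / 2) (c ^+ 2 / (2 * (41 * (`|M1 + M2| + 1)))).
have t0 : 0 < t by rewrite lt_min !divr_gt0// mulr_gt0.
have tD : t < D by rewrite gt_min; apply/orP; left; rewrite ltr_pdivrMr// ltr_pMr// ltr1n.
have [td1 te1 te2] : [/\ t < d1, t < e1 & t < e2].
  have Dm : D <= Num.min e1 e2 by rewrite /D ge_min lexx orbT.
  split; apply: lt_le_trans tD _; first by rewrite /D ge_min lexx.
    by apply: le_trans Dm _; rewrite ge_min lexx.
  by apply: le_trans Dm _; rewrite ge_min lexx orbT.
have t1 : t < 1 by apply: lt_le_trans td1 _; rewrite ge_min lexx.
have A := h1 t t0 te1; have B := h2 t t0 te2.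
have E : normc (g (- c * t)) ^+ 2 = complex.Re (g (- c * t)) ^+ 2 + complex.Im (g (- c * t)) ^+ 2.
  by case: (g _) => u w /=; rewrite sqr_sqrtr ?addr_ge0 ?sqr_ge0.
have low := wild_approach_ge x1 c0 t0 t1; rewrite -gE// E in low.
have tc : t <= c ^+ 2 / (2 * (41 * (`|M1 + M2| + 1))) by rewrite ge_min lexx orbT.
rewrite ler_pdivlMr ?mulr_gt0// in tc.
have low2 : c ^+ 2 / 41 * t <= (M1 + M2) * t ^+ 2.
  by rewrite mulrDl; apply: le_trans low _; exact: lerD.
rewrite expr2 mulrA ler_pM2r// in low2.
have Mle : (M1 + M2) * t <= `|M1 + M2| * t by rewrite ler_wpM2r ?ler_norm// ltW.
by move: (`|M1 + M2|) tc low2 Mle => M tc low2 Mle; nra.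
Qed.

End NoSmoothExtension.

Unset Implicit Arguments.

Theorem mainTheorem16 (R : realType) (n m : nat) :
  (1 <= n)%N -> (n.+1 <= m)%N ->
  exists F : 'rV[R[i]]_n -> 'M[R[i]]_m,
    [/\ holomorphic_on (unit_ball n) F,
        proper_map (unit_ball n) (D_III m) F,
        ~ C2_extends_to_boundary_piece F &
        ~ holomorphic_isometry F].
Proof.
case: n => // n _ nm; exists (ball_map nm (@sphere_poles R n)).
have a1 := @sqnorm_sphere_poles R n.
split.
- exact: holomorphic_ball_map.
- exact: proper_ball_map.
- exact: ball_map_not_C2.
- exact: not_isometry_ball_map.
Qed.
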